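(* For every $0<\alpha<\infty$, \[\max\left(\frac{2}{\alpha},\,\zeta(1+2\alpha)\right) \leq \|B_\alpha\| \leq \max\left(\frac{2}{\alpha},\,\zeta(1+\alpha)\right).\] In particular, if $0<\alpha\leq\alpha_0=1.48\ldots$, then $\|B_\alpha\|=2/\alpha$.
   Context: For $0<\alpha<\infty$, $B_\alpha$ denotes the bilinear form \[B_\alpha(a,b) := \sum_{m=1}^\infty \sum_{n=1}^\infty a_m b_n \frac{(mn)^{\alpha-1/2}}{[\max(m,n)]^{2\alpha}},\] and $\|B_\alpha\|$ denotes its norm on $\ell^2\times\ell^2$, i.e. the smallest positive number $C_\alpha$ such that $|B_\alpha(a,b)|\leq C_\alpha\|a\|_{\ell^2}\|b\|_{\ell^2}$ for every pair of sequences $a=(a_m)_{m\ge1}$, $b=(b_n)_{n\geq1}$ in $\ell^2$ (complex sequences). $\zeta(s)=\sum_{n\geq1}n^{-s}$ is the Riemann zeta function, and $\alpha_0=1.48\ldots$ is the unique positive solution of the equation $\alpha\zeta(1+\alpha)=2$. *)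

(* Defs.v *)
From Stdlib Require Import Reals.
From Coquelicot Require Import Coquelicot.
Open Scope R_scope.

(* Sequences [(a_m)_(m >= 1)] are functions [nat -> C] whose value at [m] is the
   term of index [m + 1]. *)

Definition in_l2 (a : nat -> C) : Prop := ex_series (fun m => Cmod (a m) ^ 2).

Definition l2_norm (a : nat -> C) : R := sqrt (Series (fun m => Cmod (a m) ^ 2)).

Definition kernel (alpha : R) (m n : nat) : R :=
  Rpower (INR (S m) * INR (S n)) (alpha - 1 / 2)
  / Rpower (Rmax (INR (S m)) (INR (S n))) (2 * alpha).

(* Relational, so that convergence of the iterated series is part of the claim.
   The kernel is positive, so having this for all [a], [b] in l^2 (hence for
   their moduli) makes the double series absolutely convergent. *)
Definition is_form (alpha : R) (a b : nat -> C) (s : C) : Prop :=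
  exists row : nat -> C,
    (forall m, is_series (fun n => a m * b n * RtoC (kernel alpha m n))%C (row m))
    /\ is_series row s.

Definition form_bound (alpha K : R) : Prop :=
  forall a b : nat -> C, in_l2 a -> in_l2 b ->
  exists s : C, is_form alpha a b s /\ Cmod s <= K * l2_norm a * l2_norm b.

Definition is_form_norm (alpha N : R) : Prop :=
  0 < N /\ form_bound alpha N
  /\ forall K : R, 0 < K -> form_bound alpha K -> N <= K.

(* The Riemann zeta function on real [s > 1]; elsewhere the series diverges and
   the value is not meaningful. *)
Definition zeta (s : R) : R := Series (fun n => Rpower (INR (S n)) (- s)).

(* Main.v *)
(* Write [kernel m n = (m n)^(-1/2) * corr m n] with [corr m n = (min/max)^alpha].

   Upper bound: Schur's test with the weights [n^(-1/2)] asks that the row sums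
   [x_m = sum_(n <= N) corr m n / n] be at most [C = max(2/alpha, zeta(1+alpha))].
   Since [corr] has a tridiagonal inverse, [x] satisfies a three-term relation,
   hence a maximum principle.  At [m = 1], [x_1 <= zeta(1+alpha)]; at [m = N] a
   maximum is at most 1; at an interior maximum [x_m <= 1 / coef], where [coef]
   is a sum of values of the logistic function at multiples of [alpha], so that
   [C * coef >= 1] follows from concavity in [alpha] and the explicit values
   at [alpha = 0, 1, 2, 4].

   Lower bounds: [corr m n >= (m n)^(-alpha)] and the sequence [n^(-alpha-1/2)]
   give [zeta(1+2 alpha)]; the truncations of [n^(-1/2)] give [2/alpha].

   Finally [alpha zeta(1+alpha)] increases on [1, 2], because
   [alpha * sum ln n / n^(1+alpha) < zeta(1+beta)] for [alpha <= beta] in [1, 2]. *)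

Require Import Defs.
From Stdlib Require Import Reals Lra Lia Psatz ZArith Compare_dec IndefiniteDescription.
From Coquelicot Require Import Coquelicot.
Open Scope R_scope.

(** * Finite sums and the Schur test *)

Lemma sum_n_S (a : nat -> R) (N : nat) : sum_n a (S N) = sum_n a N + a (S N).
Proof. exact (sum_Sn a N). Qed.

Lemma sum_n_eq (a b : nat -> R) (N : nat) :
  (forall n, a n = b n) -> sum_n a N = sum_n b N.
Proof. exact (sum_n_ext a b N). Qed.

Lemma sum_n_le (a b : nat -> R) (N : nat) :
  (forall n, (n <= N)%nat -> a n <= b n) -> sum_n a N <= sum_n b N.
Proof.
  induction N as [|N IH]; intros H.
  - rewrite !sum_O. apply H; lia.
  - rewrite !sum_n_S. apply Rplus_le_compat; [apply IH; intros; apply H; lia | apply H; lia].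
Qed.

Lemma sum_n_nonneg (a : nat -> R) (N : nat) :
  (forall n, 0 <= a n) -> 0 <= sum_n a N.
Proof.
  intros H. induction N as [|N IH].
  - rewrite sum_O. apply H.
  - rewrite sum_n_S. apply Rplus_le_le_0_compat; auto.
Qed.

Lemma sum_n_incr (a : nat -> R) (M N : nat) :
  (forall n, 0 <= a n) -> (M <= N)%nat -> sum_n a M <= sum_n a N.
Proof.
  intros H. induction 1 as [|N _ IH].
  - lra.
  - rewrite sum_n_S.  specialize (H (S N)). lra.
Qed.

Lemma sum_n_scal (c : R) (a : nat -> R) (N : nat) :
  sum_n (fun n => c * a n) N = c * sum_n a N.
Proof. exact (sum_n_mult_l c a N). Qed.

Lemma sum_n_add (a b : nat -> R) (N : nat) :
  sum_n (fun n => a n + b n) N = sum_n a N + sum_n b N.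
Proof. exact (sum_n_plus a b N). Qed.

Lemma sum_n_delta (c : nat -> R) (m N : nat) :
  (m <= N)%nat -> sum_n (fun n => if Nat.eq_dec n m then c n else 0) N = c m.
Proof.
  assert (Z : forall N, (N < m)%nat ->
            sum_n (fun n => if Nat.eq_dec n m then c n else 0) N = 0).
  { induction N0 as [|N0 IH]; intros H.
    - rewrite sum_O. destruct (Nat.eq_dec 0 m); [lia | reflexivity].
    - rewrite sum_n_S, IH; [|lia]. destruct (Nat.eq_dec (S N0) m); [lia|].
lra. }
  induction N as [|N IH]; intros H.
  - rewrite sum_O. destruct (Nat.eq_dec 0 m); [congruence | lia].
  - rewrite sum_n_S. 
    destruct (Nat.eq_dec (S N) m) as [<-|E].
    + rewrite Z by lia. lra.
    + rewrite IH by lia. lra.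
Qed.

(** Folds the square onto its lower triangle, which meets the diagonal twice. It serves the lower
    bound [2 / alpha], since triangular row sums obey a one-term recursion. *)
Lemma sum_n_symmetric (f : nat -> nat -> R) (N : nat) :
  (forall m n, f m n = f n m) ->
  sum_n (fun m => sum_n (f m) N) N
  = 2 * sum_n (fun m => sum_n (f m) m) N - sum_n (fun m => f m m) N.
Proof.
  intros Hs. induction N as [|N IH].
  - rewrite !sum_O. lra.
  - rewrite sum_n_S.
    rewrite (sum_n_eq (fun m => sum_n (f m) (S N)) (fun m => sum_n (f m) N + f (S N) m)).
    2:{ intros m. rewrite sum_n_S, (Hs m). reflexivity. }
    rewrite sum_n_add, IH, !sum_n_S. 
    change (fun n => f (S N) n) with (f (S N)). lra.
Qed.

Lemma bounded_sums_ex_series (a : nat -> R) (B : R) :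
  (forall n, 0 <= a n) -> (forall N, sum_n a N <= B) -> ex_series a.
Proof.
  intros H0 HB.
  destruct (ex_finite_lim_seq_incr (sum_n a) B) as [l Hl].
  - intros n. rewrite sum_n_S.  specialize (H0 (S n)). lra.
  - exact HB.
  - exists l. exact Hl.
Qed.

Lemma Series_le_bound (a : nat -> R) (B : R) :
  ex_series a -> (forall N, sum_n a N <= B) -> Series a <= B.
Proof.
  intros [l Hl] HB. rewrite (is_series_unique a l Hl).
  exact (is_lim_seq_le (sum_n a) (fun _ => B) l B HB Hl (is_lim_seq_const B)).
Qed.

Lemma sum_le_Series (a : nat -> R) (N : nat) :
  (forall n, 0 <= a n) -> ex_series a -> sum_n a N <= Series a.
Proof.
  intros H0 [l Hl]. rewrite (is_series_unique a l Hl).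
  apply (is_lim_seq_incr_compare (sum_n a) l Hl).
  intros n. rewrite sum_n_S.  specialize (H0 (S n)). lra.
Qed.

(* Rescaling [A] by [t] in the Schur test yields the hypothesis. *)
Lemma sq_le_of_pencil (P Q X : R) :
  0 <= P -> 0 <= Q -> (forall t, 0 < t -> 2 * t * X <= t * t * P + Q) ->
  X <= sqrt P * sqrt Q.
Proof.
  intros HP HQ H. rewrite <- sqrt_mult by assumption.
  destruct (Rle_lt_dec X 0) as [HX|HX].
  { apply Rle_trans with 0; [assumption | apply sqrt_pos]. }
  rewrite <- (sqrt_Rsqr X) by lra. apply sqrt_le_1_alt. unfold Rsqr.
  destruct HP as [HP|<-].
  (* [X / P] minimizes the quadratic [t * t * P - 2 * t * X + Q]. *)
  - assert (Ht : 0 < X / P) by (apply Rdiv_lt_0_compat; assumption).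
    specialize (H _ Ht).
    assert (E : 2 * (X / P) * X - X / P * (X / P) * P = X * X / P) by (field; lra).
    assert (H1 : X * X / P <= Q) by lra.
    apply (Rmult_le_compat_r P) in H1; [|lra].
    replace (X * X / P * P) with (X * X) in H1 by (field; lra). lra.
  (* With [P = 0] the hypothesis is linear in [t]; this [t] makes it read [Q + 1 <= Q]. *)
  - assert (Ht : 0 < (Q + 1) / (2 * X)) by (apply Rdiv_lt_0_compat; lra).
    specialize (H _ Ht).
    replace (2 * ((Q + 1) / (2 * X)) * X) with (Q + 1) in H by (field; lra). lra.
Qed.

(** The weighted inequality between arithmetic and geometric means splits each product [A m * B n]
    into two squares. Since [k] is symmetric, the same row condition bounds both resulting sums. *)
Lemma schur_test (k : nat -> nat -> R) (w A B : nat -> R) (C : R) (N : nat) :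
  0 <= C -> (forall m n, k m n = k n m) -> (forall m n, 0 <= k m n) ->
  (forall n, 0 < w n) ->
  (forall m, (m <= N)%nat -> sum_n (fun n => k m n * w n) N <= C * w m) ->
  sum_n (fun m => sum_n (fun n => A m * B n * k m n) N) N
  <= C * (sqrt (sum_n (fun m => A m ^ 2) N) * sqrt (sum_n (fun n => B n ^ 2) N)).
Proof.
  intros HC Hs Hk Hw Hr.
  assert (half : forall D, sum_n (fun m => sum_n (fun n => D m ^ 2 * (k m n * w n) / w m) N) N
                      <= C * sum_n (fun m => D m ^ 2) N).
  { intros D. rewrite <- sum_n_scal. apply sum_n_le. intros m Hm.
    rewrite (sum_n_eq _ (fun n => D m ^ 2 / w m * (k m n * w n))).
    2:{ intros n. field. specialize (Hw m); lra. }
    rewrite sum_n_scal.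
    replace (C * D m ^ 2) with (D m ^ 2 / w m * (C * w m)) by (field; specialize (Hw m); lra).
    apply Rmult_le_compat_l; [|apply Hr; exact Hm].
    apply Rdiv_le_0_compat; [apply pow2_ge_0 | apply Hw]. }
  assert (PA := sum_n_nonneg (fun m => A m ^ 2) N (fun m => pow2_ge_0 _)).
  assert (PB := sum_n_nonneg (fun m => B m ^ 2) N (fun m => pow2_ge_0 _)).
  rewrite <- (sqrt_sqrt C HC) at 1.
  replace (sqrt C * sqrt C * _) with
    ((sqrt C * sqrt (sum_n (fun m => A m ^ 2) N)) * (sqrt C * sqrt (sum_n (fun n => B n ^ 2) N)))
    by ring.
  rewrite <- !sqrt_mult by assumption.
  apply sq_le_of_pencil; [nra | nra |].
  intros t Ht.
  apply Rle_trans with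
    (t * t * sum_n (fun m => sum_n (fun n => A m ^ 2 * (k m n * w n) / w m) N) N
     + sum_n (fun m => sum_n (fun n => B m ^ 2 * (k m n * w n) / w m) N) N).
  2:{ pose proof (half A). pose proof (half B). nra. }
  (* Exchanging the summations in the [B] part alone places [A m] and [B n] in the same term, so the
     comparison becomes termwise. *)
  rewrite (sum_n_switch (fun m n => B m ^ 2 * (k m n * w n) / w m) N N).
  rewrite <- !sum_n_scal, <- sum_n_add.
  apply sum_n_le. intros m _. rewrite <- !sum_n_scal, <- sum_n_add.
  apply sum_n_le. intros n _.
  rewrite (Hs n m).
  assert (E : t * t * (A m ^ 2 * (k m n * w n) / w m) + B n ^ 2 * (k m n * w m) / w n
          - 2 * t * (A m * B n * k m n)
          = k m n * (t * A m * w n - B n * w m) ^ 2 / (w m * w n))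
    by (field; split; [specialize (Hw n) | specialize (Hw m)]; lra).
  assert (0 <= k m n * (t * A m * w n - B n * w m) ^ 2 / (w m * w n)).
  { apply Rdiv_le_0_compat.
    - apply Rmult_le_pos; [apply Hk | apply pow2_ge_0].
    - apply Rmult_lt_0_compat; apply Hw. }
  lra.
Qed.

(** * The complex double series and finite sections *)

Lemma kernel_pos (alpha : R) (m n : nat) : 0 < kernel alpha m n.
Proof. apply Rdiv_lt_0_compat; apply exp_pos. Qed.

Lemma kernel_sym (alpha : R) (m n : nat) : kernel alpha m n = kernel alpha n m.
Proof. unfold kernel. now rewrite Rmult_comm, Rmax_comm. Qed.

Lemma is_series_C_unique (a : nat -> C) (l l' : C) :
  is_series a l -> is_series a l' -> l = l'.
Proof.
  intros H H'.
  exact (@filterlim_locally_unique nat C_AbsRing C_NormedModule eventually _ (sum_n a) l l' H H').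
Qed.

Lemma is_series_Cmod_le (a : nat -> C) (b : nat -> R) (l : C) (B : R) :
  is_series a l -> (forall n, Cmod (a n) <= b n) -> (forall N, sum_n b N <= B) ->
  Cmod l <= B.
Proof.
  intros Hl Hab HB.
  assert (Hn : is_lim_seq (fun N => Cmod (sum_n a N)) (Cmod l)).
  { exact (filterlim_comp _ _ _ (sum_n a) Cmod _ _ _ Hl
             (@filterlim_norm C_AbsRing C_NormedModule l)). }
  apply (is_lim_seq_le _ (fun _ => B) (Cmod l) B) in Hn; [exact Hn | | apply is_lim_seq_const].
  intros N. apply Rle_trans with (sum_n (fun n => Cmod (a n)) N).
  - exact (@norm_sum_n_m C_AbsRing C_NormedModule a 0 N).
  - eapply Rle_trans; [apply sum_n_le; intros n _; apply Hab | apply HB].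
Qed.

Lemma is_series_finite_support {K : AbsRing} {V : NormedModule K} (a : nat -> V) (N : nat) :
  (forall n, (N < n)%nat -> a n = zero) -> is_series a (sum_n a N).
Proof.
  intros H. apply filterlim_ext_loc with (fun _ => sum_n a N).
  2:{ apply filterlim_const. }
  exists N. intros n Hn. induction Hn as [|n Hn IH]; [reflexivity|].
  now rewrite sum_Sn, H, plus_zero_r by lia.
Qed.

(** Applied to the moduli, the section bound controls all squares, hence all rectangles, of a
    nonnegative double series. Letting the inner and then the outer limit tend to infinity gives
    absolute convergence with the same bound. *)
Lemma form_bound_of_sections (alpha K : R) :
  0 <= K ->
  (forall (A B : nat -> R) (N : nat),
     sum_n (fun m => sum_n (fun n => A m * B n * kernel alpha m n) N) N
     <= K * (sqrt (sum_n (fun m => A m ^ 2) N) * sqrt (sum_n (fun n => B n ^ 2) N))) ->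
  form_bound alpha K.
Proof.
  intros HK Hfin a b Ha Hb.
  set (t := fun m n => Cmod (a m) * Cmod (b n) * kernel alpha m n).
  set (L := K * l2_norm a * l2_norm b).
  assert (Ht : forall m n, 0 <= t m n).
  { intros m n. apply Rmult_le_pos; [apply Rmult_le_pos; apply Cmod_ge_0|].
    apply Rlt_le, kernel_pos. }
  assert (Hsq : forall N, sum_n (fun m => sum_n (t m) N) N <= L).
  { intros N. eapply Rle_trans.
    { exact (Hfin (fun m => Cmod (a m)) (fun n => Cmod (b n)) N). }
    unfold L. rewrite Rmult_assoc. apply Rmult_le_compat_l; [exact HK|].
    apply Rmult_le_compat; try apply sqrt_pos;
      apply sqrt_le_1_alt, sum_le_Series; try assumption; intros; apply pow2_ge_0. }
  assert (Hrect : forall M N, sum_n (fun m => sum_n (t m) N) M <= L).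
  { intros M N. apply Rle_trans with (2 := Hsq (max M N)).
    apply Rle_trans with (sum_n (fun m => sum_n (t m) N) (max M N)).
    - apply sum_n_incr; [intros; now apply sum_n_nonneg | lia].
    - apply sum_n_le. intros m _. apply sum_n_incr; [apply Ht | lia]. }
  assert (Hrow : forall m, ex_series (t m)).
  { intros m. apply bounded_sums_ex_series with L; [apply Ht|].
    intros N. apply Rle_trans with (2 := Hrect m N).
    destruct m as [|m].
    - rewrite sum_O. apply Rle_refl.
    - rewrite sum_n_S.
      pose proof (sum_n_nonneg (fun m => sum_n (t m) N) m
                    (fun i => sum_n_nonneg (t i) N (Ht i))). simpl in *. lra. }
  assert (Hrow0 : forall m, 0 <= Series (t m)).
  { intros m. apply Rle_trans with (2 := sum_le_Series (t m) 0 (Ht m) (Hrow m)).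
    rewrite sum_O. apply Ht. }
  assert (Hsum : forall M, sum_n (fun m => Series (t m)) M <= L).
  { intros M.
    assert (Hlim : is_lim_seq (fun N => sum_n (fun m => sum_n (t m) N) M)
                     (sum_n (fun m => Series (t m)) M)).
    { clear - Hrow. induction M as [|M IH].
      - rewrite sum_O. apply is_lim_seq_ext with (sum_n (t 0%nat)).
        { intros N. now rewrite sum_O. }
        exact (Series_correct _ (Hrow 0%nat)).
      - rewrite sum_n_S.
        apply is_lim_seq_ext with
          (fun N => sum_n (fun m => sum_n (t m) N) M + sum_n (t (S M)) N).
        { intros N. now rewrite sum_n_S. }
        apply (is_lim_seq_plus' _ _ _ _ IH). exact (Series_correct _ (Hrow (S M))). }
    exact (is_lim_seq_le _ (fun _ => L) _ L (fun N => Hrect M N) Hlim (is_lim_seq_const L)). }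
  set (z := fun m n => (a m * b n * RtoC (kernel alpha m n))%C).
  assert (Hz : forall m n, Cmod (z m n) <= t m n).
  { intros m n. unfold z, t. rewrite !Cmod_mult, Cmod_R, (Rabs_pos_eq (kernel _ _ _)).
    - apply Rle_refl.
    - apply Rlt_le, kernel_pos. }
  assert (Hzrow : forall m, ex_series (z m)).
  { intros m. exact (@ex_series_le C_AbsRing C_CompleteNormedModule (z m) (t m)
                       (Hz m) (Hrow m)). }
  (* [is_form] asks for one function giving all row sums, hence the choice. *)
  destruct (functional_choice _ Hzrow) as [row Hrows].
  assert (Hrowle : forall m, Cmod (row m) <= Series (t m)).
  { intros m. apply (is_series_Cmod_le (z m) (t m)); [apply Hrows | apply Hz |].
    intros N. now apply sum_le_Series. }
  assert (Hs : ex_series row).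
  { apply (@ex_series_le C_AbsRing C_CompleteNormedModule row (fun m => Series (t m)) Hrowle).
    now apply bounded_sums_ex_series with L. }
  destruct Hs as [s Hs]. exists s. split.
  - exists row. split; assumption.
  - exact (is_series_Cmod_le row _ s L Hs Hrowle Hsum).
Qed.

Lemma sum_n_RtoC (c : nat -> R) (N : nat) : sum_n (fun n => RtoC (c n)) N = RtoC (sum_n c N).
Proof.
  induction N as [|N IH].
  - now rewrite !sum_O.
  - rewrite sum_n_S, RtoC_plus, <- IH. exact (sum_Sn (fun n => RtoC (c n)) N).
Qed.

Definition truncation (c : nat -> R) (N n : nat) : C :=
  if le_dec n N then RtoC (c n) else RtoC 0.

Lemma is_series_RtoC_truncation (c : nat -> R) (N : nat) :
  is_series (truncation c N) (RtoC (sum_n c N)).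
Proof.
  rewrite <- sum_n_RtoC.
  rewrite (sum_n_ext_loc _ (truncation c N)).
  - apply (@is_series_finite_support C_AbsRing C_NormedModule). intros n Hn. unfold truncation. destruct (le_dec n N); [lia | reflexivity].
  - intros n Hn. unfold truncation. destruct (le_dec n N); [reflexivity | contradiction].
Qed.

(** For a truncated sequence every series in [is_form] is a finite sum, so a form bound can be
    tested on finite sections. *)
Lemma form_bound_section (alpha K : R) (c : nat -> R) (N : nat) :
  form_bound alpha K ->
  sum_n (fun m => sum_n (fun n => c m * c n * kernel alpha m n) N) N
  <= K * sum_n (fun n => c n ^ 2) N.
Proof.
  intros HK. set (a := truncation c N).
  assert (Hsq : is_series (fun n => Cmod (a n) ^ 2) (sum_n (fun n => c n ^ 2) N)).
  { rewrite (sum_n_ext_loc _ (fun n => Cmod (a n) ^ 2)).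
    - apply (@is_series_finite_support R_AbsRing R_NormedModule).
      intros n Hn. unfold a, truncation. destruct (le_dec n N); [lia|].
      rewrite Cmod_0. change (0 ^ 2 = 0). ring.
    - intros n Hn. unfold a, truncation. destruct (le_dec n N); [|contradiction].
      rewrite Cmod_R. symmetry. apply pow2_abs. }
  assert (Ha : in_l2 a) by (eexists; exact Hsq).
  destruct (HK a a Ha Ha) as [s [[row [Hrow Hs]] Hle]].
  set (S0 := fun m => sum_n (fun n => c m * c n * kernel alpha m n) N) in *.
  assert (Hrow' : forall m, row m = truncation S0 N m).
  { intros m. apply (is_series_C_unique _ _ _ (Hrow m)).
    unfold truncation. destruct (le_dec m N) as [Hm|Hm].
    - eapply is_series_ext; [|apply is_series_RtoC_truncation].
      intros n. cbv beta. unfold a, truncation. destruct (le_dec m N); [|contradiction].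
      destruct (le_dec n N).
      + now rewrite !RtoC_mult.
      + now rewrite Cmult_0_r, Cmult_0_l.
    - apply is_series_ext with (truncation (fun _ => 0) N).
      + intros n. unfold a, truncation. destruct (le_dec m N); [contradiction|].
        rewrite !Cmult_0_l. now destruct (le_dec n N).
      + replace (RtoC 0) with (RtoC (sum_n (fun _ => 0) N)).
        * apply is_series_RtoC_truncation.
        * f_equal. rewrite sum_n_const. apply Rmult_0_r. }
  assert (Es : s = RtoC (sum_n S0 N)).
  { apply (is_series_C_unique _ _ _ Hs).
    eapply is_series_ext; [|apply is_series_RtoC_truncation].
    intros m. cbv beta. now rewrite Hrow'. }
  rewrite Es, Cmod_R in Hle.
  apply Rle_trans with (1 := Rle_abs _). apply Rle_trans with (1 := Hle).
  unfold l2_norm. rewrite (is_series_unique _ _ Hsq), Rmult_assoc, sqrt_sqrt.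
  - apply Rle_refl.
  - apply sum_n_nonneg. intros n. apply pow2_ge_0.
Qed.

Lemma is_form_unique (alpha : R) (a b : nat -> C) (s s' : C) :
  is_form alpha a b s -> is_form alpha a b s' -> s = s'.
Proof.
  intros [row [Hrow Hs]] [row' [Hrow' Hs']].
  apply (is_series_C_unique row _ _ Hs).
  apply is_series_ext with row'; [|exact Hs'].
  intros m. exact (is_series_C_unique _ _ _ (Hrow' m) (Hrow m)).
Qed.

(** The norm is the infimum of the positive bounds. It is itself a bound because the value of the
    form at a given pair does not depend on the bound ([is_form_unique]); [L] keeps it positive. *)
Lemma form_norm_exists (alpha K0 L : R) :
  form_bound alpha K0 -> 0 < L ->
  (forall K, 0 < K -> form_bound alpha K -> L <= K) ->
  L <= K0 -> exists N, is_form_norm alpha N /\ L <= N <= K0.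
Proof.
  intros H0 HL Hlow HLK.
  (* Negation turns the infimum into the supremum that [completeness] provides. *)
  set (E := fun x => 0 < - x /\ form_bound alpha (- x)).
  destruct (completeness E) as [M [Hub Hleast]].
  - exists (- L). intros x [Hx Hb]. specialize (Hlow _ Hx Hb). lra.
  - exists (- K0). split; rewrite Ropp_involutive; [lra | exact H0].
  - assert (HM : L <= - M).
    { assert (M <= - L); [|lra]. apply Hleast.
      intros x [Hx Hb]. specialize (Hlow _ Hx Hb). lra. }
    assert (Hlb : forall K, 0 < K -> form_bound alpha K -> - M <= K).
    { intros K HK Hb. assert (- K <= M); [|lra].
      apply Hub. split; rewrite Ropp_involutive; assumption. }
    exists (- M). split; [split; [lra | split; [|exact Hlb]] |].
    2:{ split; [exact HM | apply Hlb; [lra | exact H0]]. }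
    intros a b Ha Hb. destruct (H0 a b Ha Hb) as [s [Hs _]].
    exists s. split; [exact Hs|]. apply Rnot_lt_le. intros Hlt.
    set (P := l2_norm a * l2_norm b).
    assert (HP : 0 <= P) by (apply Rmult_le_pos; apply sqrt_pos).
    assert (Hall : forall K, 0 < K -> form_bound alpha K -> Cmod s <= K * P).
    { intros K _ HbK. destruct (HbK a b Ha Hb) as [s' [Hs' Hle]].
      rewrite (is_form_unique _ _ _ _ _ Hs Hs'). unfold P. lra. }
    rewrite Rmult_assoc in Hlt. fold P in Hlt.
    destruct HP as [HP|HP].
    + assert (Hlt' : - M < Cmod s / P).
      { apply Rmult_lt_reg_r with P; [exact HP|]. field_simplify; lra. }
      assert (M <= - (Cmod s / P)); [|lra].
      apply Hleast. intros x [Hx HbK]. specialize (Hall _ Hx HbK).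
      assert (Cmod s / P <= - x); [|lra].
      apply Rmult_le_reg_r with P; [exact HP|]. field_simplify; lra.
    (* If the product of the norms vanishes there is nothing to divide by, but the bound [K0]
       already forces the form to be 0. *)
    + specialize (Hall K0). rewrite <- HP in *.
      assert (Cmod s <= K0 * 0) by (apply Hall; [lra | exact H0]). lra.
Qed.

(** * The maximum principle for row sums *)

(* [ix n = n + 1] is the paper's index of the term stored at position [n]. *)
Definition ix (n : nat) : R := INR (S n).

Definition gap (n : nat) : R := ln (ix (S n)) - ln (ix n).

(** As an exponential of a distance on the logarithmic scale, this factors along consecutive gaps:
    the Markov property behind [corr_up] and [corr_down]. *)
Definition corr (alpha : R) (m n : nat) : R :=
  exp (- (alpha * Rabs (ln (ix m) - ln (ix n)))).

Lemma ix_S (n : nat) : ix (S n) = ix n + 1.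
Proof. exact (S_INR (S n)). Qed.

Lemma ix_ge_1 (n : nat) : 1 <= ix n.
Proof. unfold ix. rewrite S_INR. pose proof (pos_INR n). lra. Qed.

Lemma ix_pos (n : nat) : 0 < ix n.
Proof. pose proof (ix_ge_1 n). lra. Qed.

Lemma ix_le (m n : nat) : (m <= n)%nat -> ix m <= ix n.
Proof. intros H. apply le_INR. lia. Qed.

Lemma ln_ix_0 : ln (ix 0) = 0.
Proof. exact ln_1. Qed.

Lemma ln_ix_le (m n : nat) : (m <= n)%nat -> ln (ix m) <= ln (ix n).
Proof. intros H. apply ln_le; [apply ix_pos | now apply ix_le]. Qed.

Lemma ln_ix_nonneg (n : nat) : 0 <= ln (ix n).
Proof. rewrite <- ln_ix_0. apply ln_ix_le. lia. Qed.

Lemma exp_neg_gap (n : nat) : exp (- gap n) = ix n / ix (S n).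
Proof.
  unfold gap. replace (- _) with (ln (ix n) + - ln (ix (S n))) by ring.
  rewrite exp_plus, exp_Ropp, !exp_ln by apply ix_pos. reflexivity.
Qed.

Lemma ln_le_sub_1 (x : R) : 0 < x -> ln x <= x - 1.
Proof. intros Hx. pose proof (exp_ineq1_le (ln x)). rewrite exp_ln in *; lra. Qed.

Lemma gap_upper (n : nat) : gap n <= / ix n.
Proof.
  unfold gap. rewrite <- ln_div by apply ix_pos.
  eapply Rle_trans.
  - apply ln_le_sub_1. apply Rdiv_lt_0_compat; apply ix_pos.
  - rewrite ix_S. pose proof (ix_pos n). right. field. lra.
Qed.

Lemma gap_lower (n : nat) : / ix (S n) <= gap n.
Proof.
  pose proof (exp_ineq1_le (- gap n)) as H. rewrite exp_neg_gap in H.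
  pose proof (ix_pos n). rewrite ix_S in *.
  replace (ix n / (ix n + 1)) with (1 - / (ix n + 1)) in H by (field; lra). lra.
Qed.

Lemma gap_pos (n : nat) : 0 < gap n.
Proof.
  pose proof (gap_lower n). pose proof (Rinv_0_lt_compat _ (ix_pos (S n))). lra.
Qed.

Lemma kernel_eq (alpha : R) (m n : nat) :
  kernel alpha m n = exp (- (ln (ix m) / 2)) * exp (- (ln (ix n) / 2)) * corr alpha m n.
Proof.
  assert (main : forall m n, (m <= n)%nat ->
    kernel alpha m n = exp (- (ln (ix m) / 2)) * exp (- (ln (ix n) / 2)) * corr alpha m n).
  { clear m n. intros m n H. unfold kernel, corr. fold (ix m). fold (ix n).
    rewrite Rmax_right by now apply ix_le. unfold Rdiv at 1, Rpower.
    rewrite <- exp_Ropp, <- !exp_plus, ln_mult by apply ix_pos. f_equal.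
    pose proof (ln_ix_le m n H).
    rewrite Rabs_left1 by lra. field. }
  destruct (le_ge_dec m n) as [H|H]; [now apply main|].
  rewrite kernel_sym, main by exact H. unfold corr.
  rewrite Rabs_minus_sym. ring.
Qed.

Lemma corr_sym (alpha : R) (m n : nat) : corr alpha m n = corr alpha n m.
Proof. unfold corr. now rewrite Rabs_minus_sym. Qed.

Lemma corr_diag (alpha : R) (n : nat) : corr alpha n n = 1.
Proof.
  unfold corr. rewrite Rminus_diag, Rabs_R0, Rmult_0_r, Ropp_0. apply exp_0.
Qed.

Lemma corr_up (alpha : R) (m n : nat) :
  (n <= m)%nat -> corr alpha (S m) n = exp (- (alpha * gap m)) * corr alpha m n.
Proof.
  intros H. unfold corr, gap. rewrite <- exp_plus. f_equal.
  pose proof (ln_ix_le n m H). pose proof (ln_ix_le m (S m) ltac:(lia)).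
  rewrite !Rabs_pos_eq by lra. ring.
Qed.

Lemma corr_down (alpha : R) (m n : nat) :
  (m < n)%nat -> corr alpha m n = exp (- (alpha * gap m)) * corr alpha (S m) n.
Proof.
  intros H. unfold corr, gap. rewrite <- exp_plus. f_equal.
  pose proof (ln_ix_le m (S m) ltac:(lia)). pose proof (ln_ix_le (S m) n H).
  rewrite !Rabs_left1 by lra. ring.
Qed.

Definition row_sum (alpha : R) (N m : nat) : R := sum_n (fun n => corr alpha m n / ix n) N.

(** Auxiliary unknown that splits the three-term relation of the row sums into two first-order
    ones. *)
Definition tail_sum (alpha : R) (N m : nat) : R :=
  sum_n (fun n => if le_dec m n then corr alpha m n / ix n else 0) N.

(** With [r] the exponential, the step from [m] to [S m] multiplies the terms [n <= m] by [r] and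
    divides the others by [r]. The former cancel in the difference, and the latter keep the factor
    [1 - r ^ 2]. *)
Lemma row_sum_step (alpha : R) (N m : nat) :
  row_sum alpha N (S m) - exp (- (alpha * gap m)) * row_sum alpha N m
  = (1 - exp (- (alpha * gap m)) ^ 2) * tail_sum alpha N (S m).
Proof.
  unfold row_sum, tail_sum. set (r := exp _).
  rewrite <- (sum_n_scal (1 - r ^ 2)).
  transitivity (sum_n (fun n => corr alpha (S m) n / ix n) N
                + sum_n (fun n => - r * (corr alpha m n / ix n)) N).
  { rewrite sum_n_scal. ring. }
  rewrite <- sum_n_add. apply sum_n_eq. intros n.
  destruct (le_dec (S m) n) as [H|H].
  - rewrite (corr_down alpha m n) by lia. fold r. unfold Rdiv. ring.
  - rewrite (corr_up alpha m n) by lia. fold r. unfold Rdiv. ring.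
Qed.

Lemma tail_sum_step (alpha : R) (N m : nat) :
  (m <= N)%nat ->
  tail_sum alpha N m - exp (- (alpha * gap m)) * tail_sum alpha N (S m) = / ix m.
Proof.
  intros Hm. unfold tail_sum. set (r := exp _).
  rewrite <- (sum_n_delta (fun n => / ix n) m N Hm).
  transitivity
    (sum_n (fun n => if le_dec m n then corr alpha m n / ix n else 0) N
     + sum_n (fun n => - r * (if le_dec (S m) n then corr alpha (S m) n / ix n else 0)) N).
  { rewrite sum_n_scal, <- Ropp_mult_distr_l. reflexivity. }
  rewrite <- sum_n_add. apply sum_n_eq. intros n.
  destruct (Nat.eq_dec n m) as [->|E].
  - destruct (le_dec m m), (le_dec (S m) m); try lia. rewrite corr_diag. unfold Rdiv. ring.
  - destruct (le_dec m n), (le_dec (S m) n); try lia.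
    + rewrite (corr_down alpha m n) by lia. fold r. unfold Rdiv. ring.
    + ring.
Qed.

Lemma tail_sum_beyond (alpha : R) (N : nat) : tail_sum alpha N (S N) = 0.
Proof.
  unfold tail_sum. rewrite (sum_n_ext_loc _ (fun _ => 0)).
  - rewrite sum_n_const. apply Rmult_0_r.
  - intros n Hn. destruct (le_dec (S N) n); [lia | reflexivity].
Qed.

Lemma finite_argmax (x : nat -> R) (N : nat) :
  exists m, (m <= N)%nat /\ forall j, (j <= N)%nat -> x j <= x m.
Proof.
  induction N as [|N [m [Hm IH]]].
  - exists 0%nat. split; [lia|]. intros j Hj. replace j with 0%nat by lia. lra.
  - destruct (Rle_dec (x m) (x (S N))) as [H|H].
    + exists (S N). split; [lia|]. intros j Hj.
      destruct (Nat.eq_dec j (S N)) as [->|E]; [lra|].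
      specialize (IH j ltac:(lia)). lra.
    + exists m. split; [lia|]. intros j Hj.
      destruct (Nat.eq_dec j (S N)) as [->|E]; [lra|]. apply IH. lia.
Qed.

Definition logistic (t : R) : R := / (1 + exp (- t)).

(* At an interior maximum both neighbours can be replaced by the maximal value
   itself in the three-term relation satisfied by the row sums. *)
Lemma row_sum_interior_max (alpha : R) (N k : nat) :
  0 < alpha -> (S k <= N)%nat ->
  row_sum alpha N k <= row_sum alpha N (S k) ->
  row_sum alpha N (S (S k)) <= row_sum alpha N (S k) ->
  row_sum alpha N (S k)
  * (logistic (alpha * gap k) + logistic (alpha * gap (S k)) - 1) <= / ix (S k).
Proof.
  intros Ha HN H1 H2.
  pose proof (row_sum_step alpha N k) as E1.
  pose proof (row_sum_step alpha N (S k)) as E2.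
  rewrite <- (tail_sum_step alpha N (S k) HN).
  unfold logistic.
  assert (Hr : forall j, 0 < exp (- (alpha * gap j)) < 1).
  { intros j. split; [apply exp_pos|]. rewrite <- exp_0. apply exp_increasing.
    pose proof (gap_pos j). nra. }
  pose proof (Hr k). pose proof (Hr (S k)).
  set (r := exp (- (alpha * gap k))) in *. set (q := exp (- (alpha * gap (S k)))) in *.
  set (x := row_sum alpha N (S k)) in *.
  set (T1 := tail_sum alpha N (S k)) in *. set (T2 := tail_sum alpha N (S (S k))) in *.
  (* Replacing the left neighbour by [x] in [E1] bounds [T1] below; replacing the right one in [E2]
     bounds [T2] above. Both enter [T1 - q * T2], which equals the right-hand side. *)
  assert (B1 : x * / (1 + r) <= T1).
  { apply Rmult_le_reg_r with (1 - r ^ 2); [nra|].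
    replace (x * / (1 + r) * (1 - r ^ 2)) with (x * (1 - r)) by (field; lra). nra. }
  assert (B2 : T2 <= x * / (1 + q)).
  { apply Rmult_le_reg_r with (1 - q ^ 2); [nra|].
    replace (x * / (1 + q) * (1 - q ^ 2)) with (x * (1 - q)) by (field; lra). nra. }
  replace (/ (1 + r) + / (1 + q) - 1) with (/ (1 + r) - q * / (1 + q)) by (field; lra).
  nra.
Qed.

(** At the last index the tail is the single term [/ ix (S k)], at most 1/2; with [r] the
    exponential, the maximum is at most [(1 + r) / 2]. *)
Lemma row_sum_last_max (alpha : R) (k : nat) :
  0 < alpha -> row_sum alpha (S k) k <= row_sum alpha (S k) (S k) ->
  row_sum alpha (S k) (S k) <= 1.
Proof.
  intros Ha H.
  pose proof (row_sum_step alpha (S k) k) as E1.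
  pose proof (tail_sum_step alpha (S k) (S k) ltac:(lia)) as E2.
  rewrite tail_sum_beyond, Rmult_0_r, Rminus_0_r in E2. rewrite E2 in E1.
  assert (Hr : 0 < exp (- (alpha * gap k)) < 1).
  { split; [apply exp_pos|]. rewrite <- exp_0. apply exp_increasing.
    pose proof (gap_pos k). nra. }
  set (r := exp (- (alpha * gap k))) in *. set (x := row_sum alpha (S k) (S k)) in *.
  assert (Hi : / ix (S k) <= / 2).
  { apply Rinv_le_contravar; [lra|]. rewrite ix_S. pose proof (ix_ge_1 k). lra. }
  assert (H2 : (1 - r ^ 2) * / ix (S k) <= (1 - r ^ 2) * / 2)
    by (apply Rmult_le_compat_l; nra).
  assert (H3 : x * (1 - r) <= x - r * row_sum alpha (S k) k) by nra.
  nra.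
Qed.

Lemma row_sum_le (alpha C : R) (N m : nat) :
  0 < alpha -> 1 <= C -> row_sum alpha N 0 <= C ->
  (forall k, 1 <= C * (ix (S k)
                       * (logistic (alpha * gap k) + logistic (alpha * gap (S k)) - 1))) ->
  (m <= N)%nat -> row_sum alpha N m <= C.
Proof.
  intros Ha HC H0 Hc Hm.
  destruct (finite_argmax (row_sum alpha N) N) as [j [Hj Hmax]].
  apply Rle_trans with (1 := Hmax m Hm). clear m Hm.
  destruct j as [|k]; [exact H0|].
  destruct (Nat.eq_dec (S k) N) as [<-|E].
  { apply Rle_trans with 1; [|exact HC].
    apply row_sum_last_max; [exact Ha | apply Hmax; lia]. }
  pose proof (row_sum_interior_max alpha N k Ha Hj (Hmax k ltac:(lia))
                (Hmax (S (S k)) ltac:(lia))) as Hx.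
  specialize (Hc k). set (c := _ + _ - 1) in *.
  pose proof (ix_pos (S k)) as Hp.
  apply (Rmult_le_compat_r (ix (S k))) in Hx; [|lra].
  rewrite Rinv_l in Hx by lra.
  (* The hypothesis [1 <= C * (ix (S k) * c)] with [C] positive rules out a nonpositive coefficient,
     which makes the division legitimate. *)
  assert (Hpos : 0 < ix (S k) * c).
  { apply Rnot_le_lt. intros Hneg. nra. }
  apply Rmult_le_reg_r with (ix (S k) * c); nra.
Qed.

(** * Zeta sums and the logistic function *)

Definition zeta_term (alpha : R) (n : nat) : R := Rpower (ix n) (- (1 + alpha)).

Lemma Rpower_pos (x y : R) : 0 < Rpower x y.
Proof. apply exp_pos. Qed.

Lemma Rpower_ix_0 (y : R) : Rpower (ix 0) y = 1.
Proof. unfold Rpower. rewrite ln_ix_0, Rmult_0_r. apply exp_0. Qed.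

Lemma zeta_term_pos (alpha : R) (n : nat) : 0 < zeta_term alpha n.
Proof. apply Rpower_pos. Qed.

Lemma zeta_term_eq (alpha : R) (n : nat) :
  zeta_term alpha n = Rpower (ix n) (- alpha) / ix n.
Proof.
  unfold zeta_term. replace (- (1 + alpha)) with (- alpha + - (1)) by ring.
  rewrite Rpower_plus, (Rpower_Ropp _ 1), Rpower_1 by apply ix_pos. reflexivity.
Qed.

Lemma corr_0_eq (alpha : R) (n : nat) : corr alpha 0 n = Rpower (ix n) (- alpha).
Proof.
  unfold corr, Rpower. rewrite ln_ix_0.
  pose proof (ln_ix_nonneg n). rewrite Rabs_left1 by lra. f_equal. ring.
Qed.

Lemma Rpower_ix_step (alpha : R) (n : nat) :
  Rpower (ix (S n)) (- alpha) = Rpower (ix n) (- alpha) * exp (- (alpha * gap n)).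
Proof. unfold Rpower, gap. rewrite <- exp_plus. f_equal. ring. Qed.

(** One half of the integral comparison for [x ^ (-1 - alpha)] on a unit interval, drawn from the
    bounds on [gap] and [1 + x <= exp x]; [telescope_upper] is the other half. *)
Lemma telescope_lower (alpha : R) (n : nat) :
  0 < alpha ->
  alpha * zeta_term alpha (S n) <= Rpower (ix n) (- alpha) - Rpower (ix (S n)) (- alpha).
Proof.
  intros Ha. rewrite zeta_term_eq.
  assert (E : Rpower (ix n) (- alpha) = Rpower (ix (S n)) (- alpha) * exp (alpha * gap n)).
  { rewrite Rpower_ix_step, Rmult_assoc, <- exp_plus.
    replace (_ + _) with 0 by ring. rewrite exp_0. ring. }
  rewrite E. pose proof (exp_ineq1_le (alpha * gap n)). pose proof (gap_lower n).
  pose proof (Rpower_pos (ix (S n)) (- alpha)).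
  set (P := Rpower _ _) in *. unfold Rdiv.
  assert (alpha * / ix (S n) <= exp (alpha * gap n) - 1) by nra. nra.
Qed.

Lemma telescope_upper (alpha : R) (n : nat) :
  0 < alpha ->
  Rpower (ix n) (- alpha) - Rpower (ix (S n)) (- alpha) <= alpha * zeta_term alpha n.
Proof.
  intros Ha. rewrite zeta_term_eq, Rpower_ix_step.
  pose proof (exp_ineq1_le (- (alpha * gap n))). pose proof (gap_upper n).
  pose proof (Rpower_pos (ix n) (- alpha)).
  set (P := Rpower _ _) in *. unfold Rdiv.
  assert (1 - exp (- (alpha * gap n)) <= alpha * / ix n) by nra. nra.
Qed.

(** Partial sums corrected by the integral tail from the last index decrease. *)
Lemma zeta_section_upper (alpha : R) (M N : nat) :
  0 < alpha ->
  sum_n (zeta_term alpha) M <= sum_n (zeta_term alpha) N + Rpower (ix N) (- alpha) / alpha.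
Proof.
  intros Ha.
  assert (step : forall n, sum_n (zeta_term alpha) (S n) + Rpower (ix (S n)) (- alpha) / alpha
                      <= sum_n (zeta_term alpha) n + Rpower (ix n) (- alpha) / alpha).
  { intros n. rewrite sum_n_S. pose proof (telescope_lower alpha n Ha) as H.
    apply (Rmult_le_compat_r (/ alpha)) in H; [|left; now apply Rinv_0_lt_compat].
    replace (alpha * zeta_term alpha (S n) * / alpha) with (zeta_term alpha (S n)) in H
      by (field; lra).
    unfold Rdiv. lra. }
  assert (pos : forall n, 0 < Rpower (ix n) (- alpha) / alpha).
  { intros n. apply Rdiv_lt_0_compat; [apply Rpower_pos | exact Ha]. }
  destruct (le_ge_dec M N) as [H|H].
  - specialize (pos N).
    pose proof (sum_n_incr (zeta_term alpha) M N (fun n => Rlt_le _ _ (zeta_term_pos alpha n)) H).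
    lra.
  - assert (sum_n (zeta_term alpha) M + Rpower (ix M) (- alpha) / alpha
            <= sum_n (zeta_term alpha) N + Rpower (ix N) (- alpha) / alpha).
    { induction H as [|M _ IH]; [lra|]. specialize (step M). lra. }
    specialize (pos M). lra.
Qed.

Lemma zeta_convergent (alpha : R) : 0 < alpha -> ex_series (zeta_term alpha).
Proof.
  intros Ha. eapply bounded_sums_ex_series.
  - intros n. apply Rlt_le, zeta_term_pos.
  - intros M. apply (zeta_section_upper alpha M 0 Ha).
Qed.

Lemma zeta_upper (alpha : R) (N : nat) :
  0 < alpha ->
  zeta (1 + alpha) <= sum_n (zeta_term alpha) N + Rpower (ix N) (- alpha) / alpha.
Proof.
  intros Ha. apply (Series_le_bound (zeta_term alpha)).
  - now apply zeta_convergent.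
  - intros M. now apply zeta_section_upper.
Qed.

Lemma zeta_ge_section (alpha : R) (N : nat) :
  0 < alpha -> sum_n (zeta_term alpha) N <= zeta (1 + alpha).
Proof.
  intros Ha. apply (sum_le_Series (zeta_term alpha)).
  - intros n. apply Rlt_le, zeta_term_pos.
  - now apply zeta_convergent.
Qed.

Lemma Rpower_ix_lim (alpha : R) :
  0 < alpha -> is_lim_seq (fun n => Rpower (ix n) (- alpha)) 0.
Proof.
  intros Ha. unfold Rpower.
  apply (is_lim_comp_seq exp (fun n => - alpha * ln (ix n)) m_infty 0).
  - exact is_lim_exp_m.
  - exists 0%nat. discriminate.
  - replace m_infty with (Rbar_mult (- alpha) p_infty).
    2:{ simpl. destruct (Rle_dec 0 (- alpha)); [exfalso; lra | reflexivity]. }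
    apply is_lim_seq_scal_l.
    apply (is_lim_comp_seq ln ix p_infty p_infty).
    + exact is_lim_ln_p.
    + exists 0%nat. discriminate.
    + apply (is_lim_seq_incr_1 INR), is_lim_seq_INR.
Qed.

(** Here the integral starts at the first omitted index, hence [S N]. The corrected partial sums
    then increase, and the correction tends to 0. *)
Lemma zeta_lower (alpha : R) (N : nat) :
  0 < alpha ->
  sum_n (zeta_term alpha) N + Rpower (ix (S N)) (- alpha) / alpha <= zeta (1 + alpha).
Proof.
  intros Ha.
  assert (H : forall j, sum_n (zeta_term alpha) N + Rpower (ix (S N)) (- alpha) / alpha
                   <= zeta (1 + alpha) + / alpha * Rpower (ix (j + S N)) (- alpha)).
  { intros j. apply Rle_trans with
      (sum_n (zeta_term alpha) (j + N) + Rpower (ix (S (j + N))) (- alpha) / alpha).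
    - induction j as [|j IH]; [apply Rle_refl|].
      apply Rle_trans with (1 := IH). change (S j + N)%nat with (S (j + N)).
      rewrite sum_n_S. pose proof (telescope_upper alpha (S (j + N)) Ha) as H.
      apply (Rmult_le_compat_r (/ alpha)) in H; [|left; now apply Rinv_0_lt_compat].
      replace (alpha * zeta_term alpha (S (j + N)) * / alpha)
        with (zeta_term alpha (S (j + N))) in H by (field; lra).
      unfold Rdiv. lra.
    - rewrite <- plus_n_Sm. pose proof (zeta_ge_section alpha (j + N) Ha).
      unfold Rdiv. lra. }
  replace (zeta (1 + alpha)) with (zeta (1 + alpha) + / alpha * 0) by ring.
  refine (is_lim_seq_le _ _ (Finite _) (Finite _) H (is_lim_seq_const _) _).
  apply is_lim_seq_plus'; [apply is_lim_seq_const|].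
  apply (is_lim_seq_scal_l _ (/ alpha) 0).
  apply (is_lim_seq_incr_n (fun j => Rpower (ix j) (- alpha)) (S N)).
  now apply Rpower_ix_lim.
Qed.

Lemma zeta_gt_1 (alpha : R) : 0 < alpha -> 1 < zeta (1 + alpha).
Proof.
  intros Ha. pose proof (zeta_lower alpha 0 Ha) as H.
  rewrite sum_O in H. unfold zeta_term in H. rewrite Rpower_ix_0 in H.
  pose proof (Rdiv_lt_0_compat _ _ (Rpower_pos (ix 1) (- alpha)) Ha). lra.
Qed.

Lemma ix_1 : ix 1 = 2.
Proof. unfold ix. simpl. ring. Qed.

Lemma ix_2 : ix 2 = 3.
Proof. unfold ix. simpl. ring. Qed.

Lemma zeta_lower_2 (alpha : R) :
  0 < alpha ->
  1 + Rpower 2 (- alpha) / 2 + Rpower 3 (- alpha) / alpha <= zeta (1 + alpha).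
Proof.
  intros Ha. pose proof (zeta_lower alpha 1 Ha) as H.
  rewrite sum_n_S, sum_O, !zeta_term_eq, Rpower_ix_0, ix_1, ix_2 in H.
  change (ix 0) with 1 in H. lra.
Qed.

(** * Concavity of the logistic function and the interior coefficients *)

Lemma logistic_increasing (s t : R) : s <= t -> logistic s <= logistic t.
Proof.
  intros H. unfold logistic. apply Rinv_le_contravar.
  - pose proof (exp_pos (- t)). lra.
  - apply Rplus_le_compat_l. destruct (Req_dec s t) as [->|E]; [lra|].
    left. apply exp_increasing. lra.
Qed.

Lemma logistic_derivative (t : R) :
  derivable_pt_lim logistic t (exp (- t) / (1 + exp (- t)) ^ 2).
Proof.
  apply is_derive_Reals. unfold logistic. auto_derive.
  - pose proof (exp_pos (- t)). lra.
  - field. pose proof (exp_pos (- t)). lra.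
Qed.

Lemma logistic_derivative_decreasing (s t : R) :
  0 <= s <= t ->
  exp (- t) / (1 + exp (- t)) ^ 2 <= exp (- s) / (1 + exp (- s)) ^ 2.
Proof.
  intros H.
  assert (Hst : exp (- t) <= exp (- s)).
  { destruct (Req_dec s t) as [->|E]; [lra|]. left. apply exp_increasing. lra. }
  assert (Hs : exp (- s) <= 1).
  { rewrite <- exp_0. destruct (Req_dec s 0) as [->|E]; [rewrite Ropp_0; lra|].
    left. apply exp_increasing. lra. }
  pose proof (exp_pos (- t)).
  set (v := exp (- t)) in *. set (u := exp (- s)) in *.
  apply Rmult_le_reg_r with ((1 + v) ^ 2 * (1 + u) ^ 2).
  { apply Rmult_lt_0_compat; apply pow_lt; lra. }
  replace (v / (1 + v) ^ 2 * ((1 + v) ^ 2 * (1 + u) ^ 2)) with (v * (1 + u) ^ 2) by (field; lra).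
  replace (u / (1 + u) ^ 2 * ((1 + v) ^ 2 * (1 + u) ^ 2)) with (u * (1 + v) ^ 2) by (field; lra).
  (* This product is the difference of the two sides; it is nonnegative because [v <= u <= 1], which
     is where [0 <= s] enters. *)
  assert (0 <= (u - v) * (1 - u * v)) by (apply Rmult_le_pos; nra). nra.
Qed.

Lemma logistic_chord (a x b : R) :
  0 <= a -> a <= x <= b ->
  (b - x) * logistic a + (x - a) * logistic b <= (b - a) * logistic x.
Proof.
  intros Ha [[H1|<-] [H2| ->]]; try lra.
  destruct (MVT_cor2 logistic _ a x H1 (fun c _ => logistic_derivative c)) as [c [E1 Hc]].
  destruct (MVT_cor2 logistic _ x b H2 (fun c _ => logistic_derivative c)) as [d [E2 Hd]].
  pose proof (logistic_derivative_decreasing c d ltac:(lra)) as H.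
  set (u := exp (- c) / _) in *. set (v := exp (- d) / _) in *.
  assert (0 <= (u - v) * ((x - a) * (b - x)))
    by (apply Rmult_le_pos; [|apply Rmult_le_pos]; lra).
  nra.
Qed.

(** An interior maximum of the row sums, at position [S k], is at most the reciprocal of this
    quantity when it is positive. *)
Definition coef (alpha : R) (k : nat) : R :=
  ix (S k) * (logistic (alpha * gap k) + logistic (alpha * gap (S k)) - 1).

Lemma coef_increasing (alpha beta : R) (k : nat) : alpha <= beta -> coef alpha k <= coef beta k.
Proof.
  intros H. unfold coef. apply Rmult_le_compat_l; [left; apply ix_pos|].
  assert (forall j, logistic (alpha * gap j) <= logistic (beta * gap j)).
  { intros j. apply logistic_increasing. pose proof (gap_pos j). nra. }
  pose proof (H0 k). pose proof (H0 (S k)). lra.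
Qed.

Lemma coef_chord (a x b : R) (k : nat) :
  0 <= a -> a <= x <= b ->
  (b - x) * coef a k + (x - a) * coef b k <= (b - a) * coef x k.
Proof.
  intros Ha Hx. unfold coef.
  assert (H : forall j, (b - x) * logistic (a * gap j) + (x - a) * logistic (b * gap j)
                   <= (b - a) * logistic (x * gap j)).
  { intros j. pose proof (gap_pos j) as Hg.
    pose proof (logistic_chord (a * gap j) (x * gap j) (b * gap j) ltac:(nra) ltac:(nra)).
    apply Rmult_le_reg_r with (gap j); [exact Hg|]. nra. }
  pose proof (H k). pose proof (H (S k)). pose proof (ix_pos (S k)). nra.
Qed.

(** [exp (- gap k)] is the rational number [ix k / ix (S k)], so [coef] is a rational function of
    the index at every natural [alpha]. *)
Lemma logistic_nat_gap (j k : nat) :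
  logistic (INR j * gap k) = ix (S k) ^ j / (ix (S k) ^ j + ix k ^ j).
Proof.
  unfold logistic. replace (- (INR j * gap k)) with (INR j * - gap k) by ring.
  rewrite <- (ln_exp (- gap k)), exp_neg_gap. fold (Rpower (ix k / ix (S k)) (INR j)).
  rewrite Rpower_pow by (apply Rdiv_lt_0_compat; apply ix_pos).
  unfold Rdiv. rewrite Rpow_mult_distr, pow_inv.
  pose proof (pow_lt _ j (ix_pos k)). pose proof (pow_lt _ j (ix_pos (S k))). field. lra.
Qed.

Lemma coef_nat (j k : nat) :
  let q := ix (S k) in
  coef (INR j) k = q * (q ^ j / (q ^ j + (q - 1) ^ j) + (q + 1) ^ j / ((q + 1) ^ j + q ^ j) - 1).
Proof.
  intros q. unfold coef. rewrite !logistic_nat_gap.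
  replace (ix (S (S k))) with (q + 1) by (unfold q; now rewrite <- ix_S).
  replace (ix k) with (q - 1) by (unfold q; rewrite ix_S; ring). reflexivity.
Qed.

Lemma ix_S_ge_2 (k : nat) : 2 <= ix (S k).
Proof. rewrite ix_S. pose proof (ix_ge_1 k). lra. Qed.

Lemma coef_0 (k : nat) : coef 0 k = 0.
Proof. pose proof (coef_nat 0 k) as H. simpl in H. rewrite H. field. Qed.

Lemma coef_1 (k : nat) : coef 1 k = 2 * ix (S k) ^ 2 / (4 * ix (S k) ^ 2 - 1).
Proof.
  pose proof (coef_nat 1 k) as H. simpl INR in H. rewrite H.
  pose proof (ix_S_ge_2 k). field. repeat split; nra.
Qed.

Lemma coef_2 (k : nat) : coef 2 k = 4 * ix (S k) ^ 4 / (4 * ix (S k) ^ 4 + 1).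
Proof.
  pose proof (coef_nat 2 k) as H. replace (INR 2) with 2 in H by (simpl; ring). rewrite H.
  pose proof (ix_S_ge_2 k). field. repeat split; nra.
Qed.

Lemma coef_4_ge_1 (k : nat) : 1 <= coef 4 k.
Proof.
  pose proof (coef_nat 4 k) as H. replace (INR 4) with 4 in H by (simpl; ring). rewrite H.
  pose proof (ix_S_ge_2 k) as Hq. set (q := ix (S k)) in *. clearbody q. clear H.
  set (D1 := q ^ 4 + (q - 1) ^ 4). set (D2 := (q + 1) ^ 4 + q ^ 4).
  assert (H1 : 0 < D1) by (unfold D1; nra). assert (H2 : 0 < D2) by (unfold D2; nra).
  apply Rmult_le_reg_r with (D1 * D2); [nra|].
  replace (q * (q ^ 4 / D1 + (q + 1) ^ 4 / D2 - 1) * (D1 * D2))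
    with (q * (q ^ 4 * D2 + (q + 1) ^ 4 * D1 - D1 * D2)) by (field; lra).
  unfold D1, D2.
  (* Expanded in [t = q - 2], the polynomial has only nonnegative coefficients. *)
  apply Rminus_le_0. replace q with (2 + (q - 2)) by ring.
  assert (Ht : 0 <= q - 2) by lra. set (t := q - 2) in *. clearbody t.
  ring_simplify.
  repeat apply Rplus_le_le_0_compat; try lra;
    repeat apply Rmult_le_pos; try apply pow_le; lra.
Qed.

(** * Bounds for the norm *)

Lemma Rpower_Ropp_antitone (x a b : R) : 1 <= x -> a <= b -> Rpower x (- b) <= Rpower x (- a).
Proof. intros Hx H. apply Rle_Rpower; lra. Qed.

Lemma Rpower_neg_2 (x : R) : 0 < x -> Rpower x (- (2)) = / x ^ 2.
Proof.
  intros Hx. rewrite Rpower_Ropp. f_equal.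
  replace 2 with (INR 2) by (simpl; ring). now rewrite Rpower_pow.
Qed.

Lemma Rpower_neg_4 (x : R) : 0 < x -> Rpower x (- (4)) = / x ^ 4.
Proof.
  intros Hx. rewrite Rpower_Ropp. f_equal.
  replace 4 with (INR 4) by (simpl; ring). now rewrite Rpower_pow.
Qed.

(** The factor 65/64 gained over 2 compensates [coef 2 >= 64/65] in the range where the chord falls
    short of [alpha / 2]. *)
Lemma alpha_zeta_lower (alpha : R) :
  168 / 100 <= alpha <= 2 -> 65 / 32 <= alpha * zeta (1 + alpha).
Proof.
  intros Ha. pose proof (zeta_lower_2 alpha ltac:(lra)) as H.
  assert (H3 : / 9 <= Rpower 3 (- alpha)).
  { replace (/ 9) with (/ 3 ^ 2) by field. rewrite <- Rpower_neg_2 by lra.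
    apply Rpower_Ropp_antitone; lra. }
  (* Tangent line at [alpha = 2], with [ln 2] lowered to 1/2. *)
  assert (H2 : / 4 * (1 + (2 - alpha) / 2) <= Rpower 2 (- alpha)).
  { replace (- alpha) with (- (2) + (2 - alpha)) by ring.
    rewrite Rpower_plus, Rpower_neg_2 by lra.
    replace (/ 2 ^ 2) with (/ 4) by field. apply Rmult_le_compat_l; [lra|].
    apply Rle_trans with (2 := exp_ineq1_le _). pose proof ln_lt_2. nra. }
  apply (Rmult_le_compat_l alpha) in H; [|lra].
  replace (alpha * (1 + Rpower 2 (- alpha) / 2 + Rpower 3 (- alpha) / alpha))
    with (alpha + alpha * Rpower 2 (- alpha) / 2 + Rpower 3 (- alpha)) in H by (field; lra).
  nra.
Qed.

Lemma coef_bound (alpha C : R) (k : nat) :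
  0 < alpha -> 2 / alpha <= C -> zeta (1 + alpha) <= C -> 1 <= C * coef alpha k.
Proof.
  intros Ha HC1 HC2.
  assert (HaC : 2 <= alpha * C).
  { apply (Rmult_le_compat_l alpha) in HC1; [|lra].
    replace (alpha * (2 / alpha)) with 2 in HC1 by (field; lra). exact HC1. }
  pose proof (zeta_gt_1 alpha Ha) as HC0.
  pose proof (ix_S_ge_2 k) as Hq.
  pose proof (coef_1 k) as E1. pose proof (coef_2 k) as E2.
  set (q := ix (S k)) in *.
  assert (F1 : / 2 <= coef 1 k).
  { rewrite E1. apply Rmult_le_reg_r with (4 * q ^ 2 - 1); [nra|].
    replace (2 * q ^ 2 / (4 * q ^ 2 - 1) * (4 * q ^ 2 - 1)) with (2 * q ^ 2)
      by (field; nra). nra. }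
  assert (Hq4 : 16 <= q ^ 4) by (replace 16 with (2 ^ 4) by ring; apply pow_incr; lra).
  assert (F2 : 64 / 65 <= coef 2 k).
  { rewrite E2. apply Rmult_le_reg_r with (4 * q ^ 4 + 1); [lra|].
    replace (4 * q ^ 4 / (4 * q ^ 4 + 1) * (4 * q ^ 4 + 1)) with (4 * q ^ 4)
      by (field; lra). lra. }
  (* Up to 168/100 the chords over [0, 1] and [1, 2] give [coef alpha k >= alpha / 2], enough since
     [alpha * C >= 2]. Beyond that the zeta bound on [C] takes over. *)
  destruct (Rle_lt_dec alpha 1) as [H1|H1].
  { pose proof (coef_chord 0 alpha 1 k ltac:(lra) ltac:(lra)). rewrite coef_0 in *.
    assert (alpha / 2 <= coef alpha k) by nra. nra. }
  destruct (Rle_lt_dec alpha 2) as [H2|H2].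
  { pose proof (coef_chord 1 alpha 2 k ltac:(lra) ltac:(lra)) as Hch.
    (* For [q = 2] the chord over [1, 2] meets [alpha / 2] at [alpha = 32/19], just above
       168/100. *)
    destruct (Rle_lt_dec alpha (168 / 100)) as [H3|H3].
    - assert (alpha / 2 <= coef alpha k); [|nra].
      assert (G1 : coef 1 k = / 2 + / (2 * (4 * q ^ 2 - 1))) by (rewrite E1; field; nra).
      assert (G2 : coef 2 k = 1 - / (4 * q ^ 4 + 1)) by (rewrite E2; field; lra).
      assert (G3 : (alpha - 1) * / (4 * q ^ 4 + 1) <= (2 - alpha) * / (2 * (4 * q ^ 2 - 1))).
      { assert (0 < 4 * q ^ 2 - 1) by nra.
        apply Rmult_le_reg_r with ((4 * q ^ 4 + 1) * (2 * (4 * q ^ 2 - 1))); [nra|].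
        replace ((alpha - 1) * / (4 * q ^ 4 + 1) * ((4 * q ^ 4 + 1) * (2 * (4 * q ^ 2 - 1))))
          with ((alpha - 1) * (2 * (4 * q ^ 2 - 1))) by (field; lra).
        replace ((2 - alpha) * / (2 * (4 * q ^ 2 - 1)) * ((4 * q ^ 4 + 1) * (2 * (4 * q ^ 2 - 1))))
          with ((2 - alpha) * (4 * q ^ 4 + 1)) by (field; lra).
        assert (4 * q ^ 2 <= q ^ 4) by nra.
        assert (68 / 100 * (2 * (4 * q ^ 2 - 1)) <= 32 / 100 * (4 * q ^ 4 + 1)) by nra.
        apply Rle_trans with (68 / 100 * (2 * (4 * q ^ 2 - 1))).
        - apply Rmult_le_compat_r; lra.
        - apply Rle_trans with (1 := H4). apply Rmult_le_compat_r; lra. }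
      rewrite G1, G2 in Hch. nra.
    - pose proof (alpha_zeta_lower alpha ltac:(lra)) as Hz.
      assert (H65 : 65 / 32 <= alpha * C) by nra.
      assert (64 / 65 * (alpha / 2) <= coef alpha k) by nra. nra. }
  (* Up to 4, the second zeta term gives [C >= 1 + 1/32], which outweighs [coef 2 >= 64/65]. Past 4,
     [coef] and [C] are both at least 1. *)
  destruct (Rle_lt_dec alpha 4) as [H4|H4].
  - pose proof (coef_increasing 2 alpha k ltac:(lra)).
    pose proof (zeta_lower_2 alpha Ha) as Hz.
    assert (/ 16 <= Rpower 2 (- alpha)).
    { replace (/ 16) with (/ 2 ^ 4) by field. rewrite <- Rpower_neg_4 by lra.
      apply Rpower_Ropp_antitone; lra. }
    pose proof (Rdiv_lt_0_compat _ _ (Rpower_pos 3 (- alpha)) Ha).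
    assert (65 / 64 <= C) by lra. nra.
  - pose proof (coef_increasing 4 alpha k ltac:(lra)). pose proof (coef_4_ge_1 k). nra.
Qed.

Lemma row_sum_le_Rmax (alpha : R) (N m : nat) :
  0 < alpha -> (m <= N)%nat -> row_sum alpha N m <= Rmax (2 / alpha) (zeta (1 + alpha)).
Proof.
  intros Ha Hm.
  pose proof (Rmax_l (2 / alpha) (zeta (1 + alpha))) as H1.
  pose proof (Rmax_r (2 / alpha) (zeta (1 + alpha))) as H2.
  pose proof (zeta_gt_1 alpha Ha).
  apply row_sum_le; [exact Ha | lra | | | exact Hm].
  - apply Rle_trans with (2 := H2). apply Rle_trans with (2 := zeta_ge_section alpha N Ha).
    unfold row_sum. apply sum_n_le. intros n _.
    rewrite corr_0_eq, zeta_term_eq. apply Rle_refl.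
  - intros k. now apply coef_bound.
Qed.

Lemma exp_half_ln_sq (n : nat) : exp (- (ln (ix n) / 2)) * exp (- (ln (ix n) / 2)) = / ix n.
Proof.
  rewrite <- exp_plus. replace (_ + _) with (- ln (ix n)) by field.
  rewrite exp_Ropp, exp_ln by apply ix_pos. reflexivity.
Qed.

Lemma form_bound_upper (alpha : R) :
  0 < alpha -> form_bound alpha (Rmax (2 / alpha) (zeta (1 + alpha))).
Proof.
  intros Ha. set (C := Rmax _ _).
  assert (H0 : 0 <= C).
  { apply Rle_trans with (2 := Rmax_r _ _). pose proof (zeta_gt_1 alpha Ha). lra. }
  apply form_bound_of_sections; [exact H0|]. intros A B N.
  apply schur_test with (w := fun n => exp (- (ln (ix n) / 2))).
  - exact H0.
  - apply kernel_sym.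
  - intros m n. apply Rlt_le, kernel_pos.
  - intros n. apply exp_pos.
  - intros m Hm.
    (* The weight at [n] and the factor [n^(-1/2)] of the kernel combine to [/ ix n], which leaves
       [row_sum]. *)
    rewrite (sum_n_eq _ (fun n => exp (- (ln (ix m) / 2)) * (corr alpha m n / ix n))).
    + rewrite sum_n_scal, (Rmult_comm C). apply Rmult_le_compat_l.
      * apply Rlt_le, exp_pos.
      * now apply row_sum_le_Rmax.
    + intros n. rewrite kernel_eq.
      change (corr alpha m n / ix n) with (corr alpha m n * / ix n).
      rewrite <- exp_half_ln_sq. ring.
Qed.

(** * Lower bounds for the norm *)

(** With [g n = n^(-alpha - 1/2)] the kernel dominates [g m * g n]. A section [Z] of the zeta series
    thus satisfies [Z * Z <= K * Z]. *)
Lemma norm_ge_zeta (alpha K : R) :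
  0 < alpha -> 0 < K -> form_bound alpha K -> zeta (1 + 2 * alpha) <= K.
Proof.
  intros Ha HK Hb. apply (Series_le_bound (zeta_term (2 * alpha))).
  { apply zeta_convergent. lra. }
  intros N. set (g := fun n => exp (- (ln (ix n) / 2)) * corr alpha 0 n).
  pose proof (form_bound_section alpha K g N Hb) as H.
  assert (Eg : forall n, g n ^ 2 = zeta_term (2 * alpha) n).
  { intros n. unfold g, zeta_term. rewrite corr_0_eq. unfold Rpower.
    simpl. rewrite Rmult_1_r, <- !exp_plus. f_equal. field. }
  rewrite (sum_n_eq (fun n => g n ^ 2) _ N Eg) in H.
  set (Z := sum_n (zeta_term (2 * alpha)) N) in *.
  assert (HZ : Z * Z <= sum_n (fun m => sum_n (fun n => g m * g n * kernel alpha m n) N) N).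
  { unfold Z at 1. rewrite Rmult_comm, <- sum_n_scal. apply sum_n_le. intros m _.
    rewrite Rmult_comm. unfold Z. rewrite <- sum_n_scal. apply sum_n_le. intros n _.
    rewrite <- !Eg.
    replace (g m ^ 2 * g n ^ 2) with (g m * g n * (g m * g n)) by ring.
    apply Rmult_le_compat_l.
    { apply Rlt_le, Rmult_lt_0_compat; apply Rmult_lt_0_compat; apply exp_pos. }
    rewrite kernel_eq. unfold g, corr. rewrite <- !exp_plus.
    (* On exponents the claim is that the distance of [ln (ix m)] and [ln (ix n)] is at most their
       sum, both being nonnegative. *)
    match goal with |- exp ?a <= exp ?b => assert (Hab : a <= b) end.
    { rewrite ln_ix_0. pose proof (ln_ix_nonneg m). pose proof (ln_ix_nonneg n).
      rewrite (Rabs_left1 (0 - ln (ix m))), (Rabs_left1 (0 - ln (ix n))) by lra.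
      unfold Rabs. destruct (Rcase_abs _); nra. }
    destruct Hab as [Hab| ->]; [left; now apply exp_increasing | lra]. }
  assert (0 < Z).
  { apply Rlt_le_trans with (1 := zeta_term_pos (2 * alpha) 0).
    rewrite <- (sum_O (zeta_term (2 * alpha))).
    apply sum_n_incr; [intros; apply Rlt_le, zeta_term_pos | lia]. }
  nra.
Qed.

Lemma diag_row_sum_S (alpha : R) (m : nat) :
  row_sum alpha (S m) (S m) = exp (- (alpha * gap m)) * row_sum alpha m m + / ix (S m).
Proof.
  unfold row_sum. rewrite sum_n_S, corr_diag, <- sum_n_scal.
  unfold Rdiv at 2. rewrite Rmult_1_l. f_equal.
  apply sum_n_ext_loc. intros n Hn. rewrite corr_up by exact Hn.
  apply Rmult_assoc.
Qed.

Lemma row_sum_nonneg (alpha : R) (N m : nat) : 0 <= row_sum alpha N m.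
Proof.
  apply sum_n_nonneg. intros n. apply Rlt_le, Rdiv_lt_0_compat; [apply exp_pos | apply ix_pos].
Qed.

Definition harmonic (N : nat) : R := sum_n (fun n => / ix n) N.

Lemma harmonic_ge_ln (N : nat) : ln (ix (S N)) <= harmonic N.
Proof.
  unfold harmonic. induction N as [|N IH].
  - rewrite sum_O. pose proof (gap_upper 0). unfold gap in *. rewrite ln_ix_0 in *. lra.
  - rewrite sum_n_S. pose proof (gap_upper (S N)). unfold gap in *. lra.
Qed.

Lemma harmonic_unbounded (B : R) : exists N, B < harmonic N.
Proof.
  destruct (INR_unbounded (exp B)) as [N HN]. exists N.
  apply Rlt_le_trans with (2 := harmonic_ge_ln N).
  rewrite <- (ln_exp B) at 1. apply ln_increasing; [apply exp_pos|].
  apply Rlt_trans with (1 := HN). apply lt_INR. lia.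
Qed.

(* Telescopes [1 - exp (- alpha * gap m) <= alpha / ix m], so no estimate of the
   individual row sums is needed. *)
Lemma diag_row_sum_mean (alpha : R) (N : nat) :
  0 < alpha ->
  harmonic (S N) - row_sum alpha (S N) (S N)
  <= alpha * sum_n (fun m => row_sum alpha m m / ix m) N.
Proof.
  intros Ha.
  assert (step : forall m, row_sum alpha m m - row_sum alpha (S m) (S m) + / ix (S m)
                      <= alpha * (row_sum alpha m m / ix m)).
  { intros m. rewrite diag_row_sum_S. pose proof (row_sum_nonneg alpha m m).
    pose proof (exp_ineq1_le (- (alpha * gap m))). pose proof (gap_upper m).
    set (P := row_sum alpha m m) in *. unfold Rdiv.
    assert (1 - exp (- (alpha * gap m)) <= alpha * / ix m) by nra. nra. }
  unfold harmonic. induction N as [|N IH].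
  - rewrite sum_n_S, !sum_O. specialize (step 0%nat).
    assert (E : row_sum alpha 0 0 = / ix 0).
    { unfold row_sum. rewrite sum_O, corr_diag. unfold Rdiv. ring. }
    lra.
  - rewrite (sum_n_S (fun m => row_sum alpha m m / ix m)), sum_n_S.
    specialize (step (S N)). lra.
Qed.

Lemma sum_inv_sq_le (N : nat) : sum_n (fun n => / ix n * / ix n) N <= 2.
Proof.
  pose proof (zeta_section_upper 1 N 0 Rlt_0_1) as H.
  rewrite sum_O in H. unfold zeta_term at 2 in H. rewrite !Rpower_ix_0 in H.
  rewrite (sum_n_eq _ (zeta_term 1)); [lra|].
  intros n. rewrite zeta_term_eq, Rpower_Ropp, Rpower_1 by apply ix_pos. reflexivity.
Qed.

(** For the truncations of [n^(-1/2)] the squared norm is [harmonic N], and the form is at least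
    [2 / alpha * harmonic N] up to a constant independent of [N]. The divergence of the harmonic
    series removes the constant. *)
Lemma norm_ge_2_div (alpha K : R) : 0 < alpha -> form_bound alpha K -> 2 / alpha <= K.
Proof.
  intros Ha Hb. set (C := Rmax (2 / alpha) (zeta (1 + alpha))).
  assert (main : forall N, 2 / alpha * (harmonic N - C) - 2 <= K * harmonic N).
  { intros N. set (w := fun n => exp (- (ln (ix n) / 2))).
    pose proof (form_bound_section alpha K w N Hb) as H.
    rewrite (sum_n_eq (fun n => w n ^ 2) (fun n => / ix n)) in H.
    2:{ intros n. unfold w. simpl. rewrite Rmult_1_r. apply exp_half_ln_sq. }
    fold (harmonic N) in H. apply Rle_trans with (2 := H). clear H.
    rewrite (sum_n_eq _ (fun m => sum_n (fun n => / ix m * (corr alpha m n / ix n)) N)).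
    2:{ intros m. apply sum_n_eq. intros n. rewrite kernel_eq. unfold w.
        change (corr alpha m n / ix n) with (corr alpha m n * / ix n).
        rewrite <- !exp_half_ln_sq. ring. }
    rewrite (sum_n_symmetric (fun m n => / ix m * (corr alpha m n / ix n))).
    2:{ intros m n. rewrite corr_sym. unfold Rdiv. ring. }
    rewrite (sum_n_eq (fun m => / ix m * (corr alpha m m / ix m)) (fun m => / ix m * / ix m)).
    2:{ intros m. rewrite corr_diag. unfold Rdiv. ring. }
    rewrite (sum_n_eq (fun m => sum_n (fun n => / ix m * (corr alpha m n / ix n)) m)
               (fun m => row_sum alpha m m / ix m)).
    2:{ intros m. rewrite sum_n_scal. apply Rmult_comm. }
    pose proof (sum_inv_sq_le N).
    pose proof (diag_row_sum_mean alpha N Ha) as Hm.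
    (* The boundary term left by telescoping is bounded uniformly in [N] by the row sum estimate of
       the upper bound. *)
    pose proof (row_sum_le_Rmax alpha (S N) (S N) Ha ltac:(lia)) as HC. fold C in HC.
    assert (Hh : harmonic N <= harmonic (S N)).
    { unfold harmonic. rewrite sum_n_S. pose proof (Rinv_0_lt_compat _ (ix_pos (S N))). lra. }
    set (Sg := sum_n (fun m => row_sum alpha m m / ix m) N) in *.
    assert (2 / alpha * (harmonic N - C) <= 2 * Sg); [|lra].
    apply Rmult_le_reg_l with alpha; [exact Ha|].
    replace (alpha * (2 / alpha * (harmonic N - C))) with (2 * (harmonic N - C)) by (field; lra).
    lra. }
  apply Rnot_lt_le. intros Hlt. set (h := 2 / alpha) in *.
  destruct (harmonic_unbounded ((h * C + 2) / (h - K))) as [N HN].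
  specialize (main N).
  apply (Rmult_lt_compat_r (h - K)) in HN; [|lra].
  replace ((h * C + 2) / (h - K) * (h - K)) with (h * C + 2) in HN by (field; lra).
  lra.
Qed.

(** * The equation [alpha * zeta (1 + alpha) = 2] *)

Lemma ln_2_le : ln 2 <= 3 / 4.
Proof.
  rewrite <- (ln_exp (3 / 4)). apply ln_le; [lra|].
  replace (3 / 4) with (INR 8 * (3 / 32)) by (simpl; field).
  rewrite <- (ln_exp (3 / 32)). fold (Rpower (exp (3 / 32)) (INR 8)).
  rewrite Rpower_pow by apply exp_pos.
  apply Rle_trans with ((1 + 3 / 32) ^ 8); [lra|].
  apply pow_incr. pose proof (exp_ineq1_le (3 / 32)). lra.
Qed.

Lemma zeta_term_antitone (alpha beta : R) (n : nat) :
  alpha <= beta -> zeta_term beta n <= zeta_term alpha n.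
Proof. intros H. apply Rpower_Ropp_antitone; [apply ix_ge_1 | lra]. Qed.

(* The antiderivative of [- ln x / x ^ (1 + alpha)] vanishing at infinity. *)
Definition ln_tail (alpha x : R) : R := Rpower x (- alpha) * (ln x / alpha + 1 / alpha ^ 2).

Lemma ln_tail_derivative (alpha x : R) :
  0 < alpha -> 0 < x ->
  derivable_pt_lim (ln_tail alpha) x (- (ln x * Rpower x (- (1 + alpha)))).
Proof.
  intros Ha Hx. apply is_derive_Reals. unfold ln_tail, Rpower. auto_derive; [lra|].
  replace (- (1 + alpha) * ln x) with (- alpha * ln x + - ln x) by ring.
  rewrite exp_plus, exp_Ropp, exp_ln by exact Hx. field. lra.
Qed.

(** [ln x / x ^ s] decreases once [s * ln x >= 1], guaranteed here by [ln 2 > 1/2]. *)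
Lemma ln_term_antitone (s x y : R) :
  2 <= s -> 2 <= x <= y -> ln y * Rpower y (- s) <= ln x * Rpower x (- s).
Proof.
  intros Hs [Hx Hxy].
  assert (Hl : / 2 < ln x) by (apply Rlt_le_trans with (1 := ln_lt_2); apply ln_le; lra).
  assert (Hlxy : ln x <= ln y) by (apply ln_le; lra).
  set (u := ln x) in *. set (v := ln y) in *.
  replace (Rpower x (- s)) with (Rpower y (- s) * exp (s * (v - u))).
  2:{ unfold Rpower. fold u v. rewrite <- exp_plus. f_equal. ring. }
  pose proof (Rpower_pos y (- s)). pose proof (exp_ineq1_le (s * (v - u))).
  set (P := Rpower y (- s)) in *.
  assert (v <= u * exp (s * (v - u))).
  { assert (1 <= u * s) by nra. assert (0 <= (u * s - 1) * (v - u)) by nra. nra. }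
  nra.
Qed.

Lemma ln_tail_step (alpha : R) (n : nat) :
  1 <= alpha -> (1 <= n)%nat ->
  ln (ix (S n)) * zeta_term alpha (S n) <= ln_tail alpha (ix n) - ln_tail alpha (ix (S n)).
Proof.
  intros Ha Hn. pose proof (ix_le 1 n Hn) as H2. rewrite ix_1 in H2.
  assert (H1 : ix n < ix (S n)) by (rewrite ix_S; lra).
  destruct (MVT_cor2 (ln_tail alpha) (fun x => - (ln x * Rpower x (- (1 + alpha)))) _ _ H1)
    as [c [E Hc]].
  { intros c Hc. apply ln_tail_derivative; lra. }
  pose proof (ln_term_antitone (1 + alpha) c (ix (S n)) ltac:(lra) ltac:(lra)) as H.
  unfold zeta_term. replace (ix (S n) - ix n) with 1 in E by (rewrite ix_S; ring). lra.
Qed.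

(** Bounds the sections of [- alpha * zeta'(1 + alpha)]. The index 2 term is kept exactly and the
    later ones are compared with the integral from 2, where the integrand decreases. *)
Lemma ln_sum_bound (alpha : R) (N : nat) :
  1 <= alpha <= 2 -> alpha * sum_n (fun n => ln (ix n) * zeta_term alpha n) N <= 17 / 16.
Proof.
  intros Ha.
  assert (pos : forall n, 0 <= ln (ix n) * zeta_term alpha n).
  { intros n. apply Rmult_le_pos; [apply ln_ix_nonneg | apply Rlt_le, zeta_term_pos]. }
  apply Rle_trans with (alpha * sum_n (fun n => ln (ix n) * zeta_term alpha n) (S N)).
  { apply Rmult_le_compat_l; [lra|]. apply sum_n_incr; [exact pos | lia]. }
  assert (H : sum_n (fun n => ln (ix n) * zeta_term alpha n) (S N) + ln_tail alpha (ix (S N))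
              <= ln 2 * (Rpower 2 (- alpha) / 2) + ln_tail alpha 2).
  { induction N as [|N IH].
    - rewrite sum_n_S, sum_O, ln_ix_0, Rmult_0_l, Rplus_0_l, zeta_term_eq, ix_1. lra.
    - rewrite sum_n_S. pose proof (ln_tail_step alpha (S N) ltac:(lra) ltac:(lia)). lra. }
  assert (Ht : 0 <= ln_tail alpha (ix (S N))).
  { apply Rmult_le_pos; [apply Rlt_le, Rpower_pos|].
    apply Rplus_le_le_0_compat.
    - apply Rdiv_le_0_compat; [apply ln_ix_nonneg | lra].
    - apply Rdiv_le_0_compat; [lra | apply pow_lt; lra]. }
  assert (H2 : Rpower 2 (- alpha) <= / 2).
  { rewrite <- (Rpower_1 2) at 2 by lra. rewrite <- Rpower_Ropp.
    apply Rpower_Ropp_antitone; lra. }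
  pose proof (Rpower_pos 2 (- alpha)) as HP. pose proof ln_2_le as L1. pose proof ln_lt_2 as L2.
  set (Sg := sum_n _ (S N)) in *.
  assert (H3 : alpha * Sg <= Rpower 2 (- alpha) * (alpha * ln 2 / 2 + ln 2 + / alpha)).
  { apply Rle_trans with (alpha * (ln 2 * (Rpower 2 (- alpha) / 2) + ln_tail alpha 2)).
    - apply Rmult_le_compat_l; lra.
    - unfold ln_tail. right. field. lra. }
  (* Chord of the convex function [/ alpha] over [1, 2]. With [ln 2 <= 3/4] the bracket is then at
     most [9/4 - alpha/8], hence at most 17/8. *)
  assert (H4 : / alpha <= (3 - alpha) / 2).
  { apply Rmult_le_reg_l with alpha; [lra|]. rewrite Rinv_r by lra. nra. }
  assert (H5 : alpha * ln 2 / 2 + ln 2 + / alpha <= 17 / 8) by nra.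
  assert (H6 : 0 < / alpha) by (apply Rinv_0_lt_compat; lra).
  assert (H7 : 0 <= alpha * ln 2 / 2 + ln 2 + / alpha) by nra.
  nra.
Qed.

Lemma zeta_antitone (alpha beta : R) :
  0 < alpha -> alpha <= beta -> zeta (1 + beta) <= zeta (1 + alpha).
Proof.
  intros Ha H. apply (Series_le_bound (zeta_term beta)).
  { apply zeta_convergent. lra. }
  intros N. apply Rle_trans with (2 := zeta_ge_section alpha N Ha).
  apply sum_n_le. intros n _. now apply zeta_term_antitone.
Qed.

(** Finite-difference form of the derivative bound: each term satisfies [exp (- x) >= 1 - x] with
    [x = (beta - alpha) * ln (ix n)]. *)
Lemma zeta_decrement (alpha beta : R) :
  1 <= alpha <= 2 -> alpha <= beta ->
  alpha * (zeta (1 + alpha) - zeta (1 + beta)) <= 17 / 16 * (beta - alpha).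
Proof.
  intros Ha Hb.
  assert (zeta (1 + alpha) <= zeta (1 + beta) + 17 / 16 * (beta - alpha) / alpha).
  { apply (Series_le_bound (zeta_term alpha)).
    { apply zeta_convergent. lra. }
    intros N. pose proof (zeta_ge_section beta N ltac:(lra)).
    assert (sum_n (zeta_term alpha) N
            <= sum_n (zeta_term beta) N
               + (beta - alpha) * sum_n (fun n => ln (ix n) * zeta_term alpha n) N).
    { rewrite <- sum_n_scal, <- sum_n_add. apply sum_n_le. intros n _.
      replace (zeta_term beta n) with
        (zeta_term alpha n * exp (- ((beta - alpha) * ln (ix n)))).
      2:{ unfold zeta_term, Rpower. rewrite <- exp_plus. f_equal. ring. }
      pose proof (exp_ineq1_le (- ((beta - alpha) * ln (ix n)))).
      pose proof (zeta_term_pos alpha n). nra. }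
    pose proof (ln_sum_bound alpha N Ha) as HL. set (L := sum_n (fun n => ln _ * _) N) in *.
    assert ((beta - alpha) * L <= 17 / 16 * (beta - alpha) / alpha); [|lra].
    apply Rmult_le_reg_l with alpha; [lra|].
    replace (alpha * (17 / 16 * (beta - alpha) / alpha)) with (17 / 16 * (beta - alpha))
      by (field; lra). nra. }
  apply Rle_trans with (alpha * (17 / 16 * (beta - alpha) / alpha)).
  - apply Rmult_le_compat_l; lra.
  - right. field. lra.
Qed.

(** The increment is [(beta - alpha) * zeta (1 + beta)] minus the decrement just bounded, and
    [zeta (1 + beta) > 9/8 > 17/16]. *)
Lemma alpha_zeta_increasing (alpha beta : R) :
  1 <= alpha -> alpha < beta <= 2 -> alpha * zeta (1 + alpha) < beta * zeta (1 + beta).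
Proof.
  intros Ha Hb. pose proof (zeta_decrement alpha beta ltac:(lra) ltac:(lra)) as H.
  assert (9 / 8 < zeta (1 + beta)); [|nra].
  pose proof (zeta_lower_2 beta ltac:(lra)) as Hz.
  assert (/ 4 <= Rpower 2 (- beta)).
  { replace (/ 4) with (/ 2 ^ 2) by field. rewrite <- Rpower_neg_2 by lra.
    apply Rpower_Ropp_antitone; lra. }
  pose proof (Rdiv_lt_0_compat _ beta (Rpower_pos 3 (- beta)) ltac:(lra)). lra.
Qed.

Lemma zeta_le_1_inv (alpha : R) : 0 < alpha -> zeta (1 + alpha) <= 1 + 1 / alpha.
Proof.
  intros Ha. pose proof (zeta_upper alpha 0 Ha) as H. rewrite sum_O in H.
  unfold zeta_term in H. rewrite !Rpower_ix_0 in H. exact H.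
Qed.

(** By monotonicity of both functions the increment lies between 0 and
    [(beta - alpha) * zeta (1 + beta)], and this zeta value is at most 2. *)
Lemma alpha_zeta_lipschitz (alpha beta : R) :
  1 <= alpha <= 2 -> 1 <= beta <= 2 ->
  Rabs (beta * zeta (1 + beta) - alpha * zeta (1 + alpha)) <= 2 * Rabs (beta - alpha).
Proof.
  assert (main : forall alpha beta, 1 <= alpha -> alpha < beta <= 2 ->
    Rabs (beta * zeta (1 + beta) - alpha * zeta (1 + alpha)) <= 2 * Rabs (beta - alpha)).
  { clear. intros alpha beta Ha Hb.
    pose proof (alpha_zeta_increasing alpha beta Ha Hb).
    pose proof (zeta_antitone alpha beta ltac:(lra) ltac:(lra)).
    pose proof (zeta_le_1_inv beta ltac:(lra)) as Hz.
    assert (1 / beta <= 1).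
    { apply Rmult_le_reg_r with beta; [lra|].
      replace (1 / beta * beta) with 1 by (field; lra). lra. }
    rewrite !Rabs_pos_eq by lra. nra. }
  intros Ha Hb. destruct (Rtotal_order alpha beta) as [H|[->|H]].
  - apply main; lra.
  - rewrite !Rminus_diag, Rabs_R0. lra.
  - rewrite Rabs_minus_sym, (Rabs_minus_sym beta). apply main; lra.
Qed.

Lemma alpha_zeta_continuous (alpha : R) :
  1 < alpha < 2 -> continuity_pt (fun x => x * zeta (1 + x)) alpha.
Proof.
  intros Ha eps Heps. exists (Rmin (eps / 4) (Rmin (alpha - 1) (2 - alpha))). split.
  { repeat apply Rmin_glb_lt; lra. }
  intros x [_ Hx]. simpl in Hx |- *. unfold R_dist in *.
  assert (H1 := Rmin_l (eps / 4) (Rmin (alpha - 1) (2 - alpha))).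
  assert (H2 := Rmin_r (eps / 4) (Rmin (alpha - 1) (2 - alpha))).
  assert (H3 := Rmin_l (alpha - 1) (2 - alpha)). assert (H4 := Rmin_r (alpha - 1) (2 - alpha)).
  assert (Hb : Rabs (x - alpha) < Rmin (alpha - 1) (2 - alpha)) by lra.
  apply Rabs_def2 in Hb as Hb'.
  pose proof (alpha_zeta_lipschitz alpha x ltac:(lra) ltac:(lra)). lra.
Qed.

(** * Numerical localization of the root *)

Lemma Rpower_inv_pow (x : R) (m d : nat) :
  (0 < d)%nat -> 0 < x -> Rpower x (- (INR m / INR d)) ^ d * x ^ m = 1.
Proof.
  intros Hd Hx. apply lt_0_INR in Hd.
  rewrite <- Rpower_pow, Rpower_mult by apply Rpower_pos.
  replace (- (INR m / INR d) * INR d) with (- INR m) by (field; lra).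
  rewrite Rpower_Ropp, Rpower_pow by exact Hx. apply Rinv_l, pow_nonzero. lra.
Qed.

(** Raising to the power [d] reduces a bound on [p ^ (- m / d)] to a comparison of integers, settled
    by computation. *)
Lemma Rpower_neg_frac_le (p a b : Z) (m d : nat) :
  (0 < d)%nat -> (0 < p)%Z -> (0 < a)%Z -> (0 < b)%Z ->
  (b ^ Z.of_nat d < a ^ Z.of_nat d * p ^ Z.of_nat m)%Z ->
  Rpower (IZR p) (- (INR m / INR d)) <= IZR a / IZR b.
Proof.
  intros Hd Hp Ha Hb H.
  apply IZR_lt in Hp, Ha, Hb, H. rewrite mult_IZR, <- !pow_IZR in H.
  apply Rnot_lt_le. intros Hlt.
  pose proof (Rpower_inv_pow (IZR p) m d Hd Hp) as E.
  set (y := Rpower _ _) in *.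
  assert (Hay : IZR a <= y * IZR b).
  { apply Rmult_le_reg_r with (/ IZR b); [now apply Rinv_0_lt_compat|].
    rewrite Rmult_assoc, Rinv_r by lra. unfold Rdiv in Hlt. lra. }
  assert (Hpow : IZR a ^ d <= (y * IZR b) ^ d) by (apply pow_incr; lra).
  rewrite Rpow_mult_distr in Hpow. pose proof (pow_lt _ m Hp).
  apply (Rmult_le_compat_r (IZR p ^ m)) in Hpow; [|lra].
  replace (y ^ d * IZR b ^ d * IZR p ^ m) with (y ^ d * IZR p ^ m * IZR b ^ d) in Hpow by ring.
  rewrite E in Hpow. lra.
Qed.

Lemma Rpower_neg_frac_ge (p a b : Z) (m d : nat) :
  (0 < d)%nat -> (0 < p)%Z -> (0 < b)%Z ->
  (a ^ Z.of_nat d * p ^ Z.of_nat m < b ^ Z.of_nat d)%Z ->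
  IZR a / IZR b <= Rpower (IZR p) (- (INR m / INR d)).
Proof.
  intros Hd Hp Hb H.
  apply IZR_lt in Hp, Hb, H. rewrite mult_IZR, <- !pow_IZR in H.
  apply Rnot_lt_le. intros Hlt.
  pose proof (Rpower_inv_pow (IZR p) m d Hd Hp) as E.
  pose proof (Rpower_pos (IZR p) (- (INR m / INR d))) as Hy.
  set (y := Rpower _ _) in *.
  assert (Hay : y * IZR b <= IZR a).
  { apply Rmult_le_reg_r with (/ IZR b); [now apply Rinv_0_lt_compat|].
    rewrite Rmult_assoc, Rinv_r by lra. unfold Rdiv in Hlt. lra. }
  assert (Hpow : (y * IZR b) ^ d <= IZR a ^ d) by (apply pow_incr; nra).
  rewrite Rpow_mult_distr in Hpow. pose proof (pow_lt _ m Hp).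
  apply (Rmult_le_compat_r (IZR p ^ m)) in Hpow; [|lra].
  replace (y ^ d * IZR b ^ d * IZR p ^ m) with (y ^ d * IZR p ^ m * IZR b ^ d) in Hpow by ring.
  rewrite E in Hpow. lra.
Qed.

(** Multiplicativity leaves only the powers of 2, 3, 5 and 7 to estimate. Position 8 is index 9;
    index 10 stands apart because the lower bound uses it only as the start of the integral. *)
Lemma ten_term_section (alpha : R) :
  let u := Rpower 2 (- alpha) in
  let v := Rpower 3 (- alpha) in
  let w := Rpower 5 (- alpha) in
  Rpower (ix 9) (- alpha) = u * w /\
  sum_n (zeta_term alpha) 8
  = 1 + u / 2 + v / 3 + u * u / 4 + w / 5 + u * v / 6 + Rpower 7 (- alpha) / 7
    + u * u * u / 8 + v * v / 9 :> R.
Proof.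
  intros u v w.
  assert (E : forall x y, 0 < x -> 0 < y ->
            Rpower (x * y) (- alpha) = Rpower x (- alpha) * Rpower y (- alpha)).
  { intros x y Hx Hy. symmetry. now apply Rpower_mult_distr. }
  unfold u, v, w.
  replace (ix 9) with (2 * 5) by (unfold ix; simpl; ring). rewrite E by lra.
  split; [reflexivity|].
  rewrite !sum_n_S, sum_O, !zeta_term_eq, Rpower_ix_0, ix_1, ix_2.
  replace (ix 3) with (2 * 2) by (unfold ix; simpl; ring).
  replace (ix 4) with 5 by (unfold ix; simpl; ring).
  replace (ix 5) with (2 * 3) by (unfold ix; simpl; ring).
  replace (ix 6) with 7 by (unfold ix; simpl; ring).
  replace (ix 7) with (2 * 2 * 2) by (unfold ix; simpl; ring).
  replace (ix 8) with (3 * 3) by (unfold ix; simpl; ring).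
  change (ix 0) with 1. rewrite !E by lra. field.
Qed.

Lemma alpha_zeta_148 : 148 / 100 * zeta (1 + 148 / 100) < 2.
Proof.
  (* The reduced fraction keeps the integer powers small. *)
  assert (Ea : 148 / 100 = INR 37 / INR 25) by (rewrite !INR_IZR_INZ; simpl; lra).
  assert (H2 : Rpower 2 (- (148 / 100)) <= 358490 / 1000000).
  { rewrite Ea. apply (Rpower_neg_frac_le 2 358490 1000000); lia. }
  assert (H3 : Rpower 3 (- (148 / 100)) <= 196727 / 1000000).
  { rewrite Ea. apply (Rpower_neg_frac_le 3 196727 1000000); lia. }
  assert (H5 : Rpower 5 (- (148 / 100)) <= 92370 / 1000000).
  { rewrite Ea. apply (Rpower_neg_frac_le 5 92370 1000000); lia. }
  assert (H7 : Rpower 7 (- (148 / 100)) <= 56139 / 1000000).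
  { rewrite Ea. apply (Rpower_neg_frac_le 7 56139 1000000); lia. }
  pose proof (zeta_upper (148 / 100) 9 ltac:(lra)) as H.
  destruct (ten_term_section (148 / 100)) as [E9 Es].
  rewrite sum_n_S, Es, zeta_term_eq, E9 in H.
  replace (ix 9) with 10 in H by (unfold ix; simpl; ring).
  pose proof (Rpower_pos 2 (- (148 / 100))). pose proof (Rpower_pos 3 (- (148 / 100))).
  pose proof (Rpower_pos 5 (- (148 / 100))).
  set (u := Rpower 2 _) in *. set (v := Rpower 3 _) in *. set (w := Rpower 5 _) in *.
  set (z := Rpower 7 _) in *.
  assert (u * u <= 358490 / 1000000 * (358490 / 1000000)) by (apply Rmult_le_compat; lra).
  assert (u * v <= 358490 / 1000000 * (196727 / 1000000)) by (apply Rmult_le_compat; lra).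
  assert (v * v <= 196727 / 1000000 * (196727 / 1000000)) by (apply Rmult_le_compat; lra).
  assert (u * w <= 358490 / 1000000 * (92370 / 1000000)) by (apply Rmult_le_compat; lra).
  assert (u * u * u <= 358490 / 1000000 * (358490 / 1000000) * (358490 / 1000000))
    by (apply Rmult_le_compat; nra).
  lra.
Qed.

Lemma alpha_zeta_149 : 2 < 149 / 100 * zeta (1 + 149 / 100).
Proof.
  assert (Ea : 149 / 100 = INR 149 / INR 100) by (rewrite !INR_IZR_INZ; simpl; lra).
  assert (H2 : 356011 / 1000000 <= Rpower 2 (- (149 / 100))).
  { rewrite Ea. apply (Rpower_neg_frac_ge 2 356011 1000000); lia. }
  assert (H3 : 194575 / 1000000 <= Rpower 3 (- (149 / 100))).
  { rewrite Ea. apply (Rpower_neg_frac_ge 3 194575 1000000); lia. }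
  assert (H5 : 90892 / 1000000 <= Rpower 5 (- (149 / 100))).
  { rewrite Ea. apply (Rpower_neg_frac_ge 5 90892 1000000); lia. }
  assert (H7 : 55054 / 1000000 <= Rpower 7 (- (149 / 100))).
  { rewrite Ea. apply (Rpower_neg_frac_ge 7 55054 1000000); lia. }
  pose proof (zeta_lower (149 / 100) 8 ltac:(lra)) as H.
  destruct (ten_term_section (149 / 100)) as [E9 Es].
  rewrite Es, E9 in H.
  set (u := Rpower 2 _) in *. set (v := Rpower 3 _) in *. set (w := Rpower 5 _) in *.
  set (z := Rpower 7 _) in *.
  assert (356011 / 1000000 * (356011 / 1000000) <= u * u) by (apply Rmult_le_compat; lra).
  assert (356011 / 1000000 * (194575 / 1000000) <= u * v) by (apply Rmult_le_compat; lra).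
  assert (194575 / 1000000 * (194575 / 1000000) <= v * v) by (apply Rmult_le_compat; lra).
  assert (356011 / 1000000 * (90892 / 1000000) <= u * w) by (apply Rmult_le_compat; lra).
  assert (356011 / 1000000 * (356011 / 1000000) * (356011 / 1000000) <= u * u * u)
    by (apply Rmult_le_compat; lra).
  lra.
Qed.

(** Monotonicity is available only from 1 on; below 1 the bound
    [alpha * zeta (1 + alpha) <= alpha + 1] suffices. *)
Lemma alpha_zeta_lt_2 (alpha beta : R) :
  0 < alpha < beta -> 1 < beta <= 2 -> beta * zeta (1 + beta) <= 2 ->
  alpha * zeta (1 + alpha) < 2.
Proof.
  intros Ha Hb H. destruct (Rle_lt_dec 1 alpha) as [H1|H1].
  - apply Rlt_le_trans with (2 := H). apply alpha_zeta_increasing; lra.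
  - pose proof (zeta_le_1_inv alpha ltac:(lra)) as Hz.
    apply (Rmult_le_compat_l alpha) in Hz; [|lra].
    replace (alpha * (1 + 1 / alpha)) with (alpha + 1) in Hz by (field; lra). lra.
Qed.

Lemma alpha_zeta_root :
  exists alpha0 : R, 148 / 100 < alpha0 < 149 / 100 /\ alpha0 * zeta (1 + alpha0) = 2.
Proof.
  pose proof alpha_zeta_148 as H1. pose proof alpha_zeta_149 as H2.
  destruct (Ranalysis5.IVT_interv (fun x => x * zeta (1 + x) - 2) (148 / 100) (149 / 100))
    as [z [Hz E]]; try lra.
  - intros a Ha. apply continuity_pt_minus.
    + apply alpha_zeta_continuous. lra.
    + apply continuity_pt_const. intros x y. reflexivity.
  - exists z. split; [|lra].
    split; apply Rnot_le_lt; intros Hle.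
    + replace z with (148 / 100) in E by lra. lra.
    + replace z with (149 / 100) in E by lra. lra.
Qed.

Theorem theorem1 :
  (forall alpha : R, 0 < alpha ->
     exists N : R, is_form_norm alpha N
       /\ Rmax (2 / alpha) (zeta (1 + 2 * alpha)) <= N
       /\ N <= Rmax (2 / alpha) (zeta (1 + alpha)))
  /\
  (exists alpha0 : R,
     unique (fun x : R => 0 < x /\ x * zeta (1 + x) = 2) alpha0
     /\ 148 / 100 <= alpha0 < 149 / 100
     /\ forall alpha : R, 0 < alpha <= alpha0 -> is_form_norm alpha (2 / alpha)).
Proof.
  split.
  - intros alpha Ha.
    assert (Hpos : 0 < 2 / alpha) by (apply Rdiv_lt_0_compat; lra).
    assert (Hlow : forall K, 0 < K -> form_bound alpha K ->
              Rmax (2 / alpha) (zeta (1 + 2 * alpha)) <= K).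
    { intros K HK Hb. apply Rmax_lub; [now apply norm_ge_2_div | now apply norm_ge_zeta]. }
    pose proof (form_bound_upper alpha Ha) as Hup.
    assert (HC : 0 < Rmax (2 / alpha) (zeta (1 + alpha))).
    { apply Rlt_le_trans with (1 := Hpos). apply Rmax_l. }
    destruct (form_norm_exists alpha _ (Rmax (2 / alpha) (zeta (1 + 2 * alpha))) Hup)
      as [N [HN HNb]].
    + apply Rlt_le_trans with (1 := Hpos). apply Rmax_l.
    + exact Hlow.
    + now apply Hlow.
    + exists N. split; [exact HN | exact HNb].
  - destruct alpha_zeta_root as [alpha0 [H0 E0]].
    exists alpha0. repeat split; try lra.
    (* A larger root is excluded up to 2 by monotonicity and beyond 2 by [zeta (1 + x) > 1]; a
       smaller one by [alpha_zeta_lt_2]. *)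
    + intros x [Hx Ex]. destruct (Rtotal_order alpha0 x) as [H|[H|H]]; [|exact H|].
      * destruct (Rle_lt_dec x 2) as [H2|H2].
        -- pose proof (alpha_zeta_increasing alpha0 x ltac:(lra) ltac:(lra)). lra.
        -- pose proof (zeta_gt_1 x Hx). nra.
      * pose proof (alpha_zeta_lt_2 x alpha0 ltac:(lra) ltac:(lra) ltac:(lra)). lra.
    + apply Rdiv_lt_0_compat; lra.
    (* Up to the root [alpha * zeta (1 + alpha) <= 2], so the maximum in the upper bound is
       [2 / alpha]. *)
    + replace (2 / alpha) with (Rmax (2 / alpha) (zeta (1 + alpha))).
      { apply form_bound_upper. lra. }
      apply Rmax_left. apply Rmult_le_reg_l with alpha; [lra|].
      replace (alpha * (2 / alpha)) with 2 by (field; lra).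
      destruct (Req_dec alpha alpha0) as [->|Hne]; [lra|].
      left. apply (alpha_zeta_lt_2 alpha alpha0); lra.
    + intros K HK Hb. apply norm_ge_2_div; [lra | exact Hb].
Qed.
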